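(* For any $c\in H^k$, the $k$-means criterion $\mathcal{R}(c)=\mathbb{P}_X\bigl(\min_{1\le j\le k}\lVert X-c_j\rVert^2\bigr)$ can be expressed as $$\mathcal{R}(c)=2\sigma^2\,\mathbb{P}_X\bigl[\mathcal{K}\bigl(Q^{(c)}_{Y\mid X},\mathbb{P}_{Y\mid X}\bigr)\bigr]=2\sigma^2\,\mathcal{K}\bigl(Q^{(c)}_{X,Y},\mathbb{P}_{X,Y}\bigr).$$
   Context: $H$ is a separable Hilbert space with orthonormal basis $(e_i)_{i\in\mathbb{N}}$, $\sigma>0$, and $(X,Y):\Omega\to H\times\mathbb{R}^{\mathbb{N}}$ is a couple of random variables (e.g. $\Omega=H\times\mathbb{R}^{\mathbb{N}}$ and $(X,Y)$ the identity). $\mathbb{P}$ is a probability measure on $\Omega$ such that $\mathbb{P}_X$ is the given law of $X$ and the conditional law of $Y$ given $X$ is $\mathbb{P}_{Y\mid X}=\bigotimes_{i\in\mathbb{N}}\mathcal{N}(\langle X,e_i\rangle,\sigma^2)$. For $c=(c_1,\dots,c_k)\in H^k$, let $\ell(x)=\min\{\arg\min_{1\le j\le k}\lVert x-c_j\rVert\}$, and let $Q^{(c)}$ be a probability measure on $\Omega$ such that $Q^{(c)}_X=\mathbb{P}_X$ and $Q^{(c)}_{Y\mid X}=\bigotimes_{i\in\mathbb{N}}\mathcal{N}(\langle c_{\ell(X)},e_i\rangle,\sigma^2)$. For a probability measure $Q$ on $\Omega$, $Q_{X,Y}$ is the joint law of $(X,Y)$ under $Q$. $\mathcal{K}(Q,P)=Q[\log(dQ/dP)]$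 if $Q\ll P$, $+\infty$ otherwise, is the Kullback divergence. $\mathbb{P}_X(f(X))$ denotes the expectation of $f(X)$ under $\mathbb{P}_X$. *)

(* Defs.v *)
From HB Require Import structures.
From mathcomp Require Import all_boot all_order all_algebra.
From mathcomp Require Import sesquilinear.
From mathcomp Require Import all_classical all_reals all_analysis.
From mathcomp Require Import measurable_realfun.

Set Implicit Arguments.
Unset Strict Implicit.
Unset Printing Implicit Defensive.

Import Order.TTheory GRing.Theory Num.Theory.
Import numFieldNormedType.Exports.

Local Open Scope classical_set_scope.
Local Open Scope ring_scope.

(* A real Hilbert space is a complete normed module H together with a
   {dot H for idfun} whose induced norm is the norm of H. The family e being
   indexed by nat, a basis in the sense below also makes H separable. *)
Definition orthonormal_basis (R : realType) (H : completeNormedModType R)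
    (dot : {dot H for idfun}) (e : nat -> H) : Prop :=
  (forall i j, dot (e i) (e j) = (i == j)%:R) /\
  dense [set x : H | exists n (a : nat -> R), x = \sum_(i < n) a i *: e i].

Definition borel (H : ptopologicalType) : measurableType (@open H).-sigma :=
  g_sigma_algebraType (@open H).
Arguments borel : clear implicits.

Definition coordinate_events (R : realType) : set (set (nat -> R)) :=
  \bigcup_i preimage_set_system setT (fun y : nat -> R => y i)
    (measurable : set (set (measurableTypeR R))).
Arguments coordinate_events : clear implicits.

(* The product sigma-algebra on R^nat. *)
Definition Rseq (R : realType) : measurableType (coordinate_events R).-sigma :=
  g_sigma_algebraType (coordinate_events R).
Arguments Rseq : clear implicits.

(* mu is the infinite product of the m_i; the value of mu on finite-dimensional
   rectangles determines it on the product sigma-algebra. *)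
Definition is_product_law (R : realType) (mu : probability (Rseq R) R)
    (m : nat -> probability (measurableTypeR R) R) : Prop :=
  forall (n : nat) (B : nat -> set (measurableTypeR R)),
    (forall i, measurable (B i)) ->
    mu [set y : nat -> R | forall i, (i < n)%N -> B i (y i)] =
    (\prod_(i < n) m i (B i))%E.

(* K is the law of a sequence of independent N(<m, e_i>, sigma^2) variables;
   the second parameter of normal_prob is the standard deviation. *)
Definition gaussian_law (R : realType) (H : completeNormedModType R)
    (dot : {dot H for idfun}) (e : nat -> H) (sigma : R) (m : H)
    (K : probability (Rseq R) R) : Prop :=
  is_product_law K (fun i => normal_prob (dot m (e i)) sigma).

(* K is a (regular) conditional law of Y given X under P. *)
Definition conditional_law (R : realType) (d d1 d2 : measure_display)
    (T : measurableType d) (T1 : measurableType d1) (T2 : measurableType d2)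
    (P : probability T R) (X : {mfun T >-> T1}) (Y : {mfun T >-> T2})
    (K : T1 -> probability T2 R) : Prop :=
  (forall B, measurable B -> measurable_fun setT (fun x => K x B)) /\
  (forall A B, measurable A -> measurable B ->
    P (X @^-1` A `&` Y @^-1` B) = (\int[distribution P X]_(x in A) K x B)%E).

Section joint.
Context (d d1 d2 : measure_display) (T : measurableType d)
  (T1 : measurableType d1) (T2 : measurableType d2)
  (X : {mfun T >-> T1}) (Y : {mfun T >-> T2}).

Definition joint (w : T) : T1 * T2 := (X w, Y w).

Let measurable_joint : measurable_fun setT joint.
Proof. by apply: measurable_fun_pair; exact: measurable_funPT. Qed.

HB.instance Definition _ := isMeasurableFun.Build _ _ _ _ joint measurable_joint.

End joint.

Definition kullback (R : realType) (d : measure_display) (T : measurableType d)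
    (Q P : probability T R) : \bar R :=
  if `[< Q `<< P >] then
    (\int[Q]_x lne (Radon_Nikodym (charge_of_finite_measure Q) P x))%E
  else +oo%E.

Definition argmin_dist (R : realType) (H : completeNormedModType R) (k : nat)
    (c : 'I_k.+1 -> H) (x : H) : {set 'I_k.+1} :=
  [set j | [forall i, `|x - c j| <= `|x - c i|]]%SET.

(* The smallest index of a nearest centre; the inner arg min only supplies the
   element of argmin_dist c x that the outer one needs as a starting point. *)
Definition ell (R : realType) (H : completeNormedModType R) (k : nat)
    (c : 'I_k.+1 -> H) (x : H) : 'I_k.+1 :=
  [arg min_(j < [arg min_(i < ord0) `|x - c i|%R]%O in argmin_dist c x)
     nat_of_ord j]%N.

Definition kmeans_risk (R : realType) (H : completeNormedModType R)
    (PX : probability (borel H) R) (k : nat) (c : 'I_k.+1 -> H) : \bar R :=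
  (\int[PX]_x
     (\big[Num.min/`|(x : H) - c ord0| ^+ 2]_(j < k.+1)
        `|(x : H) - c j| ^+ 2)%:E)%E.

(* Main.v *)
Require Import Defs.
From HB Require Import structures.
From mathcomp Require Import all_boot all_order all_algebra.
From mathcomp Require Import sesquilinear.
From mathcomp Require Import all_classical all_reals all_analysis.
From mathcomp Require Import measurable_realfun.
From mathcomp Require Import ring lra.

Set Implicit Arguments.
Unset Strict Implicit.
Unset Printing Implicit Defensive.

Import Order.TTheory GRing.Theory Num.Theory.
Import numFieldNormedType.Exports.

Local Open Scope classical_set_scope.
Local Open Scope ring_scope.

(** Write K for the law of independent N(<x, e_i>, sigma^2) variables and L for
    the one with mean m = c_(ell x). The heart of the matter is the
    Cameron-Martin formula: L has a density with respect to K and its Kullback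
    divergence is |x - m|^2 / (2 sigma^2). Since m is a nearest centre,
    |x - m|^2 is the minimum in the k-means criterion, and integrating over the
    law of X gives the first equality. The second one is the chain rule for the
    divergence, the two joint laws having the same first marginal.

    Cameron-Martin. Put b_i = (m_i - x_i) / sigma and z_i = (y_i - x_i) / sigma.
    On the first n coordinates the likelihood ratio is
    exp (sum_(i < n) b_i z_i - E_n / 2) with E_n = sum_(i < n) b_i ^ 2
    ([gaussian_tilt]), and Parseval's identity makes E_n increase to
    E = |m - x|^2 / sigma^2. Everything needed about these ratios is contained
    in the exponential moments of sum_(i < n) b_i z_i: their second moments
    ([integral_likelihood_ratioB]) show that they form a Cauchy sequence, so
    that a fast subsequence converges almost everywhere and in L^1 to some f
    ([fast_L1_cvg]), which is the density of L since the ratios have the right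
    integral on each cylinder eventually. Divergences are computed as integrals
    of the nonnegative function t ln t - t + 1 of the density
    ([kullback_density]). That of f is at most E / 2 by Fatou's lemma, and at
    least each E_n / 2 because t ln t - t + 1 is the supremum over h of
    t h - e^h + 1: take for h the logarithm of the n-th ratio.

    Chain rule ([kullback_chain_rule]). Absolute continuity for almost every x
    gives absolute continuity of the joint laws. Let h be the density of the
    joint laws. For almost every x the section h (x, .) is a density of L with
    respect to K: for one measurable set this follows by integrating over x, and a
    countable determining class is enough. Tonelli's theorem for
    t ln t - t + 1 composed with h then gives the result, also when both sides
    are infinite. *)

(** * Densities and relative entropy *)

Definition density_of (R : realType) (d : measure_display)
    (T : measurableType d) (nu mu : set T -> \bar R) (f : T -> R) : Prop :=
  forall A, measurable A -> nu A = (\int[mu]_(x in A) (f x)%:E)%E.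

Section with_density.
Context (R : realType) (d : measure_display) (T : measurableType d).
Variables (mu : {measure set T -> \bar R}) (f : T -> R).
Local Open Scope ereal_scope.

(** The hypotheses on f are arguments so that the structure of probability can be
    declared on this function. *)
Definition with_density (f0 : forall x, (0 <= f x)%R)
    (mf : measurable_fun setT f) (f1 : \int[mu]_x (f x)%:E = 1) : set T -> \bar R :=
  fun A => \int[mu]_(x in A) (f x)%:E.

Hypothesis f0 : forall x, (0 <= f x)%R.
Hypothesis mf : measurable_fun setT f.
Hypothesis f1 : \int[mu]_x (f x)%:E = 1.

Let with_density0 : with_density f0 mf f1 set0 = 0.
Proof. by rewrite /with_density integral_set0. Qed.

Let with_density_ge0 A : 0 <= with_density f0 mf f1 A.
Proof. by apply: integral_ge0 => x _; rewrite lee_fin. Qed.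

Let with_density_sigma_additive : semi_sigma_additive (with_density f0 mf f1).
Proof.
apply: semi_sigma_additive_nng_induced => //.
exact/measurable_EFinP.
Qed.

HB.instance Definition _ := isMeasure.Build _ _ _ (with_density f0 mf f1)
  with_density0 with_density_ge0 with_density_sigma_additive.

Let with_density_setT : with_density f0 mf f1 setT = 1.
Proof. exact: f1. Qed.

HB.instance Definition _ :=
  Measure_isProbability.Build _ _ _ (with_density f0 mf f1) with_density_setT.

End with_density.

Section density_theory.
Context (R : realType) (d : measure_display) (T : measurableType d).
Local Open Scope ereal_scope.

Lemma density_probability (mu : {measure set T -> \bar R}) (f : T -> R) :
  (forall x, (0 <= f x)%R) -> measurable_fun setT f ->
  \int[mu]_x (f x)%:E = 1 -> exists nu : probability T R, density_of nu mu f.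
Proof. by move=> f0 mf f1; exists (with_density f0 mf f1). Qed.

Lemma density_dominates (nu mu : {measure set T -> \bar R}) (f : T -> R) :
  measurable_fun setT f -> density_of nu mu f -> nu `<< mu.
Proof.
move=> mf nuf; apply/null_content_dominatesP => A mA muA0.
rewrite nuf// null_set_integral//; last first.
  by apply/measurable_EFinP; apply: measurable_funTS.
Qed.

Lemma density_integrable (nu : probability T R) (mu : {measure set T -> \bar R})
    (f : T -> R) :
  (forall x, (0 <= f x)%R) -> measurable_fun setT f -> density_of nu mu f ->
  mu.-integrable setT (EFin \o f).
Proof.
move=> f0 mf nuf; apply/integrableP; split; first exact/measurable_EFinP.
rewrite (eq_integral (fun x => (f x)%:E)); last first.
  by move=> x _ /=; rewrite ger0_norm.
by rewrite -nuf// probability_setT ltry.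
Qed.

(** The change of variables known for Radon-Nikodym derivatives transfers to any
    density, all densities being equal almost everywhere. *)
Lemma ge0_integral_density (nu : probability T R)
    (mu : {sigma_finite_measure set T -> \bar R}) (f : T -> R)
    (g : T -> \bar R) (E : set T) :
  (forall x, (0 <= f x)%R) -> measurable_fun setT f -> density_of nu mu f ->
  (forall x, 0 <= g x) -> measurable_fun setT g -> measurable E ->
  \int[nu]_(x in E) g x = \int[mu]_(x in E) (g x * (f x)%:E).
Proof.
move=> f0 mf nuf g0 mg mE.
have numu := density_dominates mf nuf.
have mEf : measurable_fun setT (EFin \o f) by exact/measurable_EFinP.
have mRN := measurable_int _ (Radon_Nikodym_SigmaFinite.f_integrable numu).
rewrite -(@Radon_Nikodym_SigmaFinite.change_of_variables _ _ _ nu mu)//; last first.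
  exact: measurable_funTS.
apply: ae_eq_integral => //.
- by apply: emeasurable_funM; exact: measurable_funTS.
- by apply: emeasurable_funM; exact: measurable_funTS.
- apply: ae_eqe_mul2l; apply: ae_eq_subset (@subsetT _ E) _.
  apply: integral_ae_eq => //.
    exact: Radon_Nikodym_SigmaFinite.f_integrable.
  by move=> A _ mA; rewrite -nuf// -Radon_Nikodym_SigmaFinite.f_integral.
Qed.

End density_theory.

(** The term 1 - t has integral 0 when t is a probability density, so that it
    does not change the divergence; it makes the integrand nonnegative, and
    integrals of it always make sense. *)
Definition entropy_fun (R : realType) (t : R) : R := t * ln t - t + 1.

Section entropy.
Context (R : realType).
Implicit Types t h : R.

(** Convex duality: e^h - 1 is the Legendre transform of [entropy_fun], with
    equality at h = ln t when t > 0. *)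
Lemma entropy_fun_tangent t h : 0 <= t -> t * h - expR h + 1 <= entropy_fun t.
Proof.
rewrite /entropy_fun le_eqVlt => /predU1P[<-|t0].
  by rewrite !mul0r subrr sub0r add0r gerDr oppr_le0 expR_ge0.
rewrite lerD2r -lerBlDr opprK.
have := expR_ge1Dx (h - ln t); rewrite expRD expRN lnK ?posrE// => H.
have : t * (1 + (h - ln t)) <= expR h.
  apply: le_trans (ler_wpM2l (ltW t0) H) _.
  by rewrite mulrCA mulfV ?mulr1// gt_eqF.
lra.
Qed.

Lemma entropy_fun_ge0 t : 0 <= t -> 0 <= entropy_fun t.
Proof.
by move=> t0; have := entropy_fun_tangent 0 t0; rewrite expR0 mulr0 add0r addNr.
Qed.

Lemma measurable_entropy_fun : measurable_fun setT (@entropy_fun R).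
Proof.
apply: measurable_funD => //; apply: measurable_funB => //.
by apply: measurable_funM => //; exact: measurable_ln.
Qed.

End entropy.

Section kullback.
Context (R : realType) (d : measure_display) (T : measurableType d).
Local Open Scope ereal_scope.

Lemma measurable_lne_EFin : measurable_fun setT (fun r : R => lne r%:E).
Proof.
apply: measurable_fun_ifT => //=.
  by apply: measurable_fun_ler => //; exact: measurable_cst.
by apply/measurable_EFinP; exact: measurable_ln.
Qed.

(** The integral of the logarithm of the density may be infinite, so linearity is
    used on its positive and negative parts. The negative part n of f ln f is at
    most 1 as f ln f >= f - 1, hence it can be cancelled from
    p + 1 = entropy_fun f + f + n, p being the positive part. *)
Lemma kullback_density (Q P : probability T R) (f : T -> R) :
  (forall x, (0 <= f x)%R) -> measurable_fun setT f -> density_of Q P f ->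
  kullback Q P = \int[P]_x (entropy_fun (f x))%:E.
Proof.
move=> f0 mf Qf.
have QP := density_dominates mf Qf.
have mEf : measurable_fun setT (EFin \o f) by exact/measurable_EFinP.
have mlnef : measurable_fun setT (fun x => lne (f x)%:E).
  exact: measurableT_comp measurable_lne_EFin mf.
rewrite /kullback asboolT//.
have RNf : ae_eq Q setT (Radon_Nikodym (charge_of_finite_measure Q) P) (EFin \o f).
  apply: (null_dominates_ae_eq _ QP) => //; apply: integral_ae_eq => //.
    exact: Radon_Nikodym_integrable.
  by move=> A _ mA; rewrite -Radon_Nikodym_integral// -Qf.
rewrite (ae_eq_integral (fun x => lne (f x)%:E))//; last 2 first.
- rewrite (_ : (fun x => _) = (fun r => lne r%:E) \o
      (fun x => fine (Radon_Nikodym (charge_of_finite_measure Q) P x))); last first.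
      by apply/funext => x; rewrite /comp fineK// Radon_Nikodym_fin_num.
  apply: measurableT_comp measurable_lne_EFin _.
  apply: (measurableT_comp (fine_measurable measurableT)).
  exact: measurable_int (Radon_Nikodym_integrable _).
- by apply: filterS RNf => x /= /(_ I) ->.
pose p x := Num.max (f x * ln (f x))%R 0%R.
pose n x := Num.max (- (f x * ln (f x)))%R 0%R.
have mfln : measurable_fun setT (fun x => f x * ln (f x))%R.
  by apply: measurable_funM => //; apply: measurableT_comp => //; exact: measurable_ln.
have mp : measurable_fun setT p by exact: measurable_maxr.
have mn : measurable_fun setT n.
  by apply: measurable_maxr => //; exact: measurableT_comp mfln.
have mphi : measurable_fun setT (fun x => entropy_fun (f x)).
  by apply: measurableT_comp mf; exact: measurable_entropy_fun.
have p0 x : (0 <= p x)%R by rewrite le_max lexx orbT.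
have n0 x : (0 <= n x)%R by rewrite le_max lexx orbT.
rewrite integralE.
rewrite (ge0_integral_density f0 mf Qf)//; last exact: measurable_funepos.
rewrite (ge0_integral_density f0 mf Qf)//; last exact: measurable_funeneg.
have -> : \int[P]_x ((fun x => lne (f x)%:E)^\+ x * (f x)%:E) = \int[P]_x (p x)%:E.
  apply: eq_integral => x _; rewrite funeposE /p.
  have := f0 x; rewrite le_eqVlt => /predU1P[<-|fx0].
    by rewrite mule0 mul0r maxxx.
  rewrite lne_EFin// -EFin_max -EFinM maxr_pMl ?f0// mul0r.
  by rewrite mulrC.
have -> : \int[P]_x ((fun x => lne (f x)%:E)^\- x * (f x)%:E) = \int[P]_x (n x)%:E.
  apply: eq_integral => x _; rewrite funenegE /n.
  have := f0 x; rewrite le_eqVlt => /predU1P[<-|fx0].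
    by rewrite mule0 mul0r oppr0 maxxx.
  rewrite lne_EFin// -EFinN -EFin_max -EFinM maxr_pMl ?f0// mul0r.
  by rewrite mulNr mulrC.
have nfin : \int[P]_x (n x)%:E \is a fin_num.
  rewrite ge0_fin_numE; last by apply: integral_ge0 => x _; rewrite lee_fin.
  apply: (@le_lt_trans _ _ (\int[P]_x (cst 1 x))).
    apply: ge0_le_integral => //.
    - by move=> x _; rewrite lee_fin.
    - exact/measurable_EFinP.
    - move=> x _; rewrite lee_fin /n ge_max ler01 andbT.
      have := entropy_fun_ge0 (f0 x); have := f0 x; rewrite /entropy_fun; lra.
  by rewrite integral_cst// mul1e [ltLHS](@probability_setT _ _ _ P) ltry.
have P1 : \int[P]_x (cst 1 x) = 1.
  by rewrite integral_cst// mul1e; exact: probability_setT.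
have Pf : \int[P]_x (f x)%:E = 1.
  by rewrite -(Qf _ measurableT); exact: probability_setT.
have key : \int[P]_x (p x)%:E + 1 =
    \int[P]_x (entropy_fun (f x))%:E + 1 + \int[P]_x (n x)%:E.
  rewrite -{1}P1 -[in RHS]Pf -!ge0_integralD//=; last 9 first.
    - by move=> x _; rewrite adde_ge0// lee_fin ?entropy_fun_ge0.
    - by apply: emeasurable_funD; exact/measurable_EFinP.
    - by move=> x _; rewrite lee_fin.
    - exact/measurable_EFinP.
    - by move=> x _; rewrite lee_fin ?entropy_fun_ge0.
    - exact/measurable_EFinP.
    - by move=> x _; rewrite lee_fin.
    - by move=> x _; rewrite lee_fin.
    - exact/measurable_EFinP.
  apply: eq_integral => x _; rewrite -!EFinD; congr (_%:E).
  rewrite /p /n /entropy_fun /Num.max/=; case: ifPn; case: ifPn; lra.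
have -> : \int[P]_x (p x)%:E = \int[P]_x (entropy_fun (f x))%:E + \int[P]_x (n x)%:E.
  by move/(congr1 (fun z => z - 1)) : key; rewrite addeAC !addeK.
by rewrite addeK.
Qed.

End kullback.

(** * Fast convergence of densities *)

Section fast_convergence.
Context (R : realType) (d : measure_display) (T : measurableType d).
Local Open Scope ereal_scope.

(** A pointwise form of the Cauchy-Schwarz inequality,
    2 |u| <= e + u^2 / e, with e chosen to balance both terms. *)
Lemma integral_norm_le_sqr (mu : probability T R) (u : T -> R) (e : R) :
  (0 < e)%R -> measurable_fun setT u ->
  \int[mu]_x ((u x) ^+ 2)%:E <= (e ^+ 2)%:E ->
  \int[mu]_x `|u x|%:E <= e%:E.
Proof.
move=> e0 mu_ ue.
have mu2 : measurable_fun setT (fun x => (u x ^+ 2)%R) by exact: measurable_funX.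
apply: (@le_trans _ _ (\int[mu]_x ((e / 2)%:E + ((2 * e)^-1 * (u x) ^+ 2)%:E))).
  apply: ge0_le_integral => //.
  - by apply/measurable_EFinP; exact: measurableT_comp.
  - by apply: emeasurable_funD => //; apply/measurable_EFinP; exact: measurable_funM.
  - move=> x _; rewrite -EFinD lee_fin -subr_ge0.
    rewrite (_ : (_ - _)%R = ((e - `|u x|) ^+ 2 / (2 * e))%R); last first.
      by rewrite -(real_normK (num_real (u x))); field; rewrite gt_eqF.
    by rewrite divr_ge0 ?sqr_ge0// mulr_ge0// ltW.
rewrite ge0_integralD//; last 3 first.
- by move=> x _; rewrite lee_fin divr_ge0// ltW.
- by move=> x _; rewrite lee_fin mulr_ge0 ?sqr_ge0// invr_ge0 mulr_ge0// ltW.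
- by apply/measurable_EFinP; exact: measurable_funM.
rewrite integral_cst// [X in _ * X](@probability_setT _ _ _ mu) mule1.
under eq_integral do rewrite EFinM.
rewrite ge0_integralZl//; last 3 first.
- exact/measurable_EFinP.
- by move=> x _; rewrite lee_fin sqr_ge0.
- by rewrite lee_fin invr_ge0 mulr_ge0// ltW.
apply: (@le_trans _ _ ((e / 2)%:E + ((2 * e)^-1)%:E * (e ^+ 2)%:E)).
  by rewrite leeD2l// lee_wpmul2l// lee_fin invr_ge0 mulr_ge0// ltW.
by rewrite -EFinM -EFinD lee_fin le_eqVlt; apply/orP; left; apply/eqP; field; rewrite gt_eqF.
Qed.

(** The increments have a summable L^1 norm, hence the series G of their absolute
    values is integrable. Where G is finite, which is almost everywhere, the
    sequence converges; it is dominated by its first term plus G. *)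
Lemma fast_L1_cvg (mu : probability T R) (g : nat -> T -> R) :
  (forall j x, (0 <= g j x)%R) ->
  (forall j, measurable_fun setT (g j)) ->
  mu.-integrable setT (EFin \o g 0%N) ->
  (forall j, \int[mu]_x `|g j.+1 x - g j x|%:E <= (2^-1 ^+ j)%:E) ->
  exists f : T -> R, [/\ forall x, (0 <= f x)%R, measurable_fun setT f,
    {ae mu, forall x, g ^~ x @ \oo --> f x} &
    forall A, measurable A ->
      \int[mu]_(x in A) (g n x)%:E @[n --> \oo] --> \int[mu]_(x in A) (f x)%:E].
Proof.
move=> g0 mg ig0 gg.
pose D j x := `|g j.+1 x - g j x|%R.
have mD j : measurable_fun setT (D j).
  by apply: measurableT_comp => //; exact: measurable_funB.
have mED j : measurable_fun setT (EFin \o D j) by exact/measurable_EFinP.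
have D0 j x : 0 <= (D j x)%:E by rewrite lee_fin normr_ge0.
pose G x := \sum_(j <oo) (D j x)%:E.
have G0 x : 0 <= G x by exact: nneseries_ge0.
have mG : measurable_fun setT G.
  by apply: ge0_emeasurable_sum => [k x _ _|k _]; [exact: D0|exact: mED].
have iG : mu.-integrable setT G.
  apply/integrableP; split => //.
  under eq_integral do rewrite gee0_abs//.
  rewrite integral_nneseries//.
  apply: (@le_lt_trans _ _ 2%:E); last exact: ltry.
  apply: lime_le; first by apply: is_cvg_nneseries => n _ _; exact: integral_ge0.
  apply: nearW => n.
  apply: (@le_trans _ _ (\sum_(0 <= j < n) (2^-1 ^+ j : R)%:E)).
    by apply: lee_sum => j _; exact: gg.
  rewrite sumEFin lee_fin.
  have -> : (\sum_(0 <= j < n) (2^-1 ^+ j) = series (geometric 1 2^-1) n :> R)%R.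
    by rewrite /series/=; apply: eq_bigr => j _; rewrite mul1r.
  apply: le_trans (@geometric_le_lim R n 1 2^-1 _ _ _) _ => //.
  - by rewrite ger0_norm// invf_lt1// ltr1n.
  - have -> : (1 - 2^-1 = 2^-1 :> R)%R by lra.
    by rewrite mul1r invrK.
have cvgg x : G x \is a fin_num -> cvgn (g ^~ x).
  move=> Gx.
  have : cvgn (series (telescope (g ^~ x))).
    apply: (@normed_cvg R R^o); rewrite /normed_series_of/=.
    apply: nondecreasing_is_cvgn.
      by apply: nondecreasing_series => n _ _; exact: normr_ge0.
    exists (fine (G x)) => _ [n _ <-]; rewrite -lee_fin fineK//.
    rewrite /series/= -sumEFin.
    exact: (@nneseries_lim_ge _ (fun j => (D j x)%:E) xpredT 0%N n).
  rewrite telescopeK => /cvg_ex[/= l gl].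
  apply/cvg_ex; exists (l + g 0%N x)%R.
  rewrite (_ : g ^~ x = (fun n => (g n x - g 0%N x) + g 0%N x)%R); last first.
    by apply/funext => n; rewrite subrK.
  by apply: cvgD => //; exact: cvg_cst.
(* The absolute value makes f nonnegative on the exceptional set too. *)
pose f x := `|fine (limn_esup (fun j => (g j x)%:E))|%R.
have f0 x : (0 <= f x)%R by exact: normr_ge0.
have mf : measurable_fun setT f.
  apply: measurableT_comp => //; apply: (measurableT_comp (fine_measurable measurableT)).
  by apply: measurable_fun_limn_esup => j; apply/measurable_EFinP.
have gf : {ae mu, forall x, g ^~ x @ \oo --> f x}.
  have := integrable_ae measurableT iG; apply: filterS => x /(_ I) /cvgg.
  move=> /cvg_ex[/= l gl].
  have gEl : (g j x)%:E @[j --> \oo] --> l%:E by apply: cvg_EFin => //; exact: nearW.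
  rewrite /f (is_cvg_limn_esupE (cvgP _ gEl)) (cvg_lim _ gEl)//=.
  rewrite ger0_norm//.
  rewrite -(cvg_lim (@Rhausdorff R) gl); apply: limr_ge; first exact: cvgP gl.
  exact: nearW.
exists f; split => // A mA.
have iAG : mu.-integrable A (fun x => (g 0%N x)%:E + G x).
  by apply: (integrableS measurableT) => //; exact: integrableD.
have [] := @dominated_convergence _ T R mu A mA (fun n x => (g n x)%:E)
  (EFin \o f) (fun x => (g 0%N x)%:E + G x) _ _ _ iAG _ => //.
- by move=> n; apply: measurable_funTS; exact/measurable_EFinP.
- by apply: measurable_funTS; exact/measurable_EFinP.
- by apply: filterS gf => x gfx _; apply: cvg_EFin => //; exact: nearW.
apply: aeW => x n _.
rewrite gee0_abs ?lee_fin//.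
have : (g n x <= g 0%N x + \sum_(0 <= j < n) D j x)%R.
  elim: n => [|n IH]; first by rewrite big_nil addr0.
  rewrite big_nat_recr//= addrA; have := ler_norm (g n.+1 x - g n x); rewrite -/(D n x); lra.
rewrite -lee_fin => /le_trans; apply; rewrite EFinD leeD2l// -sumEFin.
exact: (@nneseries_lim_ge _ (fun j => (D j x)%:E) xpredT 0%N n).
Qed.

End fast_convergence.

(** * Disintegration of a joint law *)

Section family_kernel.
Context (R : realType) (d1 d2 : measure_display) (T1 : measurableType d1)
  (T2 : measurableType d2) (k : T1 -> {measure set T2 -> \bar R}).
Local Open Scope ereal_scope.

(** A name for k on which the structure of probability kernel can be declared. *)
Definition family_kernel (mk : forall B, measurable B -> measurable_fun setT (k ^~ B))
  (k1 : forall x, k x setT = 1) : T1 -> {measure set T2 -> \bar R} := k.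

Hypothesis mk : forall B, measurable B -> measurable_fun setT (k ^~ B).
Hypothesis k1 : forall x, k x setT = 1.

HB.instance Definition _ := isKernel.Build _ _ _ _ _ (family_kernel mk k1) mk.
HB.instance Definition _ :=
  Kernel_isProbability.Build _ _ _ _ _ (family_kernel mk k1) k1.

End family_kernel.

Section disintegration.
Context (R : realType) (d1 d2 : measure_display) (T1 : measurableType d1)
  (T2 : measurableType d2).
Local Open Scope ereal_scope.

Lemma rectangle_measure_unique (m1 m2 : {measure set (T1 * T2) -> \bar R}) :
  m1 setT < +oo ->
  (forall A B, measurable A -> measurable B -> m1 (A `*` B) = m2 (A `*` B)) ->
  forall C, measurable C -> m1 C = m2 C.
Proof.
move=> m1T m12 C mC.
pose G := [set A `*` B | A in (measurable : set (set T1)) & B in (measurable : set (set T2))].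
refine (@measure_unique _ R _ G (fun=> setT) _ _ _ _ m1 m2 _ _ _ mC).
- exact: measurable_prod_measurableType.
- move=> _ _ [X1 mX1 [X2 mX2 <-]] [Y1 mY1 [Y2 mY2 <-]].
  exists (X1 `&` Y1); first exact: measurableI.
  by exists (X2 `&` Y2); [exact: measurableI|rewrite setXI].
- by move=> _; exists setT => //; exists setT => //; rewrite setXTT.
- by apply/seteqP; split => // y _; exists 0%N.
- by move=> _ [A mA [B mB <-]]; exact: m12.
- by move=> _.
Qed.

Variables (mu : probability T1 R) (K : T1 -> probability T2 R).
Hypothesis mK : forall B, measurable B -> measurable_fun setT (fun x => K x B).

Lemma measurable_integral_family (F : T1 * T2 -> \bar R) :
  (forall z, 0 <= F z) -> measurable_fun setT F ->
  measurable_fun setT (fun x => \int[K x]_y F (x, y)).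
Proof.
move=> F0 mF.
have K1 x : (K x : {measure set T2 -> \bar R}) setT = 1 by exact: probability_setT.
exact: (@measurable_fun_integral_finite_kernel _ _ T1 T2 R F
  (family_kernel mK K1)).
Qed.

Lemma measurable_section_family (C : set (T1 * T2)) : measurable C ->
  measurable_fun setT (fun x => K x (pair x @^-1` C)).
Proof.
move=> mC.
have K1 x : (K x : {measure set T2 -> \bar R}) setT = 1 by exact: probability_setT.
have := @measurable_fun_xsection_finite_kernel _ _ T1 T2 R (family_kernel mK K1) C (mem_set mC).
rewrite (_ : (fun x => _) = (fun x => K x (pair x @^-1` C)))//.
by apply/funext => x; congr (K x _); apply/seteqP; split => y; rewrite /xsection/= inE.
Qed.

Variable J : probability (T1 * T2)%type R.
Hypothesis JK : forall A B, measurable A -> measurable B ->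
  J (A `*` B) = \int[mu]_(x in A) K x B.

(** Tonelli's theorem for a law disintegrated along its first marginal. The law J
    is the composition of the constant kernel mu with the kernel sending x to
    the image of K x under y |-> (x, y), for which integration is known to be
    iterated. *)
Theorem integral_disintegration (F : T1 * T2 -> \bar R) :
  (forall z, 0 <= F z) -> measurable_fun setT F ->
  \int[J]_z F z = \int[mu]_x \int[K x]_y F (x, y).
Proof.
move=> F0 mF.
pose l (u : unit) : {measure set T1 -> \bar R} := mu.
have ml B : measurable B -> measurable_fun setT (l ^~ B) by move=> _; exact: measurable_cst.
have l1 u : l u setT = 1 by exact: probability_setT.
pose k0 (p : unit * T1) : {measure set (T1 * T2) -> \bar R} :=
  pushforward (K p.2) (pair p.2).
pose k := k0 (fun p => pair1_measurable p.2).
have kE p U : k p U = K p.2 (pair p.2 @^-1` U) by [].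
have mk U : measurable U -> measurable_fun setT (k ^~ U).
  move=> mU; rewrite (_ : k ^~ U = (fun x => K x (pair x @^-1` U)) \o snd)//.
  exact: measurableT_comp (measurable_section_family mU) measurable_snd.
have k1 p : k p setT = 1 by rewrite kE preimage_setT; exact: probability_setT.
have JE C : measurable C ->
    J C = kcomp (family_kernel ml l1) (family_kernel mk k1) tt C.
  apply: (@rectangle_measure_unique J
    (mkcomp (family_kernel ml l1) (family_kernel mk k1) tt)).
    by rewrite [ltLHS](@probability_setT _ _ _ J) ltry.
  move=> A B mA mB; transitivity (\int[mu]_x K x (pair x @^-1` (A `*` B))); last by [].
  rewrite [LHS]JK// [LHS]integral_mkcond; apply: eq_integral => x _.
  rewrite patchE; case: ifPn => xA.
    congr (K x _); apply/seteqP; split => y //=; last by case.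
    by move: xA; rewrite inE.
  rewrite (_ : pair x @^-1` _ = set0) ?measure0//.
  by apply/seteqP; split => y //= [Ax]; move: xA; rewrite notin_setE.
rewrite (eq_measure_integral (mkcomp (family_kernel ml l1) (family_kernel mk k1) tt)); last first.
  by move=> A mA _; exact: JE.
rewrite [LHS](@integral_kcomp _ _ _ _ _ _ _ (family_kernel ml l1) (family_kernel mk k1))//=.
apply: eq_integral => x _.
by rewrite [LHS](ge0_integral_pushforward (pair1_measurable x)).
Qed.

End disintegration.

(** * The chain rule for the Kullback divergence *)

Section nonmeasurable.
Context (R : realType) (d : measure_display) (T : measurableType d)
  (mu : {measure set T -> \bar R}).
Import HBNNSimple.
Local Open Scope ereal_scope.

(** The integral of a nonnegative function is a supremum over the simple functions
    below it, whether the function is measurable or not. This matters because a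
    conditional law is only specified almost everywhere: the divergence between
    conditional laws agrees with a measurable function outside a null set, and
    is arbitrary on it. *)
Lemma ge0_ae_eq_integral_nonmeasurable (f g : T -> \bar R) :
  (forall x, 0 <= f x) -> (forall x, 0 <= g x) -> measurable_fun setT g ->
  {ae mu, forall x, f x = g x} -> \int[mu]_x f x = \int[mu]_x g x.
Proof.
move=> f0 g0 mg fg; apply/eqP; rewrite eq_le; apply/andP; split.
  rewrite [leLHS]ge0_integralTE//; apply: ge_ereal_sup => _ [h /= hf <-].
  rewrite -integralT_nnsfun; apply: ae_ge0_le_integral => //.
  - by move=> x _; rewrite lee_fin.
  - exact/measurable_EFinP.
  - by apply: filterS fg => x <- _; exact: hf.
have [N [mN N0 fgN]] := fg.
rewrite (_ : \int[mu]_x g x = \int[mu]_x (g \_ (~` N)) x); last first.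
  apply: ge0_ae_eq_integral => //.
  - apply/(measurable_restrictT _ _).1 => //; last exact: measurable_funTS.
    exact: measurableC.
  - by move=> x _; rewrite patchE; case: ifP.
  - exists N; split => // x /=; apply: contra_notP => Nx _.
    by rewrite patchE mem_set.
rewrite [leLHS]ge0_integralTE; last by move=> x; rewrite patchE; case: ifP.
rewrite [leRHS]ge0_integralTE//; apply: le_ereal_sup => _ [h /= hg <-].
exists h => //= x.
apply: le_trans (hg x) _; rewrite patchE; case: ifPn => // xN.
rewrite le_eqVlt; apply/orP; left; apply/eqP/esym.
by apply: contrapT => fgx; move: xN; rewrite inE; apply; exact: fgN.
Qed.

Lemma ae_eq_integral_nonmeasurable (f g : T -> \bar R) :
  (forall x, 0 <= g x) -> measurable_fun setT g ->
  {ae mu, forall x, f x = g x} -> \int[mu]_x f x = \int[mu]_x g x.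
Proof.
move=> g0 mg fg; rewrite integralE.
rewrite (@ge0_ae_eq_integral_nonmeasurable f^\+ g)//; last first.
  by apply: filterS fg => x fgx; rewrite funeposE fgx; apply/max_idPl.
rewrite (@ge0_ae_eq_integral_nonmeasurable f^\- (cst 0))//; last first.
  apply: filterS fg => x fgx; rewrite funenegE fgx; apply/max_idPr.
  by rewrite leeNl oppe0.
by rewrite integral0 sube0.
Qed.

End nonmeasurable.

Section chain_rule.
Context (R : realType) (d1 d2 : measure_display) (T1 : measurableType d1)
  (T2 : measurableType d2).
Local Open Scope ereal_scope.

Variables (U : countType) (G : U -> set T2).
Hypothesis mG : forall u, measurable (G u).
Hypothesis G_determining : forall m1 m2 : probability T2 R,
  (forall u, m1 (G u) = m2 (G u)) -> forall B, measurable B -> m1 B = m2 B.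

Variables (mu : probability T1 R) (K L : T1 -> probability T2 R).
Hypothesis mK : forall B, measurable B -> measurable_fun setT (fun x => K x B).
Hypothesis mL : forall B, measurable B -> measurable_fun setT (fun x => L x B).
Variables I J : probability (T1 * T2)%type R.
Hypothesis JK : forall A B, measurable A -> measurable B ->
  J (A `*` B) = \int[mu]_(x in A) K x B.
Hypothesis IL : forall A B, measurable A -> measurable B ->
  I (A `*` B) = \int[mu]_(x in A) L x B.
Hypothesis LK : {ae mu, forall x, L x `<< K x}.

Lemma joint_section (K' : T1 -> probability T2 R) (J' : probability (T1 * T2)%type R)
    (C : set (T1 * T2)) :
  (forall B, measurable B -> measurable_fun setT (fun x => K' x B)) ->
  (forall A B, measurable A -> measurable B ->
    J' (A `*` B) = \int[mu]_(x in A) K' x B) ->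
  measurable C -> J' C = \int[mu]_x K' x (pair x @^-1` C).
Proof.
move=> mK' JK' mC; rewrite -(setIT C) -integral_indic//.
rewrite (integral_disintegration mK' JK')//; last first.
  by apply/measurable_EFinP; exact: measurable_indic.
apply: eq_integral => x _.
rewrite (_ : (fun y => _) = (fun y => (\1_(pair x @^-1` C) y)%:E))//.
rewrite integral_indic// ?setIT//.
by have := pair1_measurable x measurableT mC; rewrite setTI.
Qed.

Lemma joint_dominates : I `<< J.
Proof.
apply/null_content_dominatesP => C mC JC0.
rewrite (joint_section mL IL mC).
have mKC := measurable_section_family mK mC.
have mLC := measurable_section_family mL mC.
have msec x : measurable (pair x @^-1` C : set T2).
  by have := pair1_measurable x measurableT mC; rewrite setTI.
have : ae_eq mu setT (fun x => K x (pair x @^-1` C)) (cst 0).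
  apply/(ae_eq_integral_abs mu measurableT mKC).
  by under eq_integral do rewrite gee0_abs//; rewrite -(joint_section mK JK mC).
move=> KC0; rewrite (ae_eq_integral (cst 0))// ?integral0//.
apply: filterS2 LK KC0 => x LKx KCx0 _.
exact: ((null_content_dominatesP _ _).1 LKx _ (msec x) (KCx0 Logic.I)).
Qed.

(** Let h be the density of I with respect to J. Disintegrating
    I (A x B) = int_(A x B) h dJ for all A shows that, for each B,
    L x B = int_B h (x, y) K x (dy) for almost every x. The exceptional null set
    depends on B, so B is restricted to the countable class G, which determines
    L x. *)
Theorem kullback_chain_rule :
  kullback I J = \int[mu]_x kullback (L x) (K x).
Proof.
pose h z := fine (Radon_Nikodym_SigmaFinite.f I J z).
have IJ := joint_dominates.
have h0 z : (0 <= h z)%R by rewrite fine_ge0// Radon_Nikodym_SigmaFinite.f_ge0.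
have mh : measurable_fun setT h.
  apply: (measurableT_comp (fine_measurable measurableT)).
  exact: measurable_int (Radon_Nikodym_SigmaFinite.f_integrable IJ).
have Ih : density_of I J h.
  move=> C mC; rewrite (Radon_Nikodym_SigmaFinite.f_integral IJ)//.
  by apply: eq_integral => z _; rewrite fineK// Radon_Nikodym_SigmaFinite.f_fin_num.
have mhx x : measurable_fun setT (fun y => h (x, y)).
  exact: (measurableT_comp mh (pair1_measurable x)).
have sect B : measurable B ->
    {ae mu, forall x, L x B = \int[K x]_(y in B) (h (x, y))%:E}.
  move=> mB.
  pose F z := (h z)%:E * (\1_B z.2)%:E.
  have F0 z : 0 <= F z by rewrite mule_ge0// lee_fin.
  have mF : measurable_fun setT F.
    apply: emeasurable_funM; first exact/measurable_EFinP.
    apply/measurable_EFinP; apply: measurableT_comp => //.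
  have FE x : \int[K x]_y F (x, y) = \int[K x]_(y in B) (h (x, y))%:E.
    rewrite [RHS]integral_mkcond; apply: eq_integral => y _.
    by rewrite /F/= patchE indicE; case: ifP; rewrite ?mule1 ?mule0.
  have mFx := measurable_integral_family mK F0 mF.
  have : ae_eq mu setT (fun x => L x B) (fun x => \int[K x]_y F (x, y)).
    apply: integral_ae_eq => //.
      apply/integrableP; split; first exact: mL.
      under eq_integral do rewrite gee0_abs//.
      rewrite -IL// (le_lt_trans (probability_le1 _ _)) ?ltry//.
      exact: measurableX.
    move=> A _ mA; rewrite -IL// Ih; last exact: measurableX.
    rewrite [LHS]integral_mkcond.
    rewrite [LHS](integral_disintegration mK JK); last 2 first.
    - by move=> z; rewrite patchE; case: ifP => // _; rewrite lee_fin.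
    - apply/(measurable_restrictT _ _).1; first exact: measurableX.
      by apply: measurable_funTS; exact/measurable_EFinP.
    rewrite [RHS]integral_mkcond; apply: eq_integral => x _.
    rewrite patchE; case: ifPn => xA.
      apply: eq_integral => y _; rewrite /F patchE indicE/= in_setX xA/=.
      by case: ifP; rewrite ?mule1 ?mule0.
    rewrite integral0_eq// => y _; rewrite patchE in_setX/= (negbTE xA)//.
  by apply: filterS => x /(_ Logic.I) ->; rewrite FE.
(* The sets of G are numbered by [unpickle] to intersect countably many almost
   sure events. *)
have dens : {ae mu, forall x, density_of (L x) (K x) (fun y => h (x, y))}.
  have secU : {ae mu, forall x, forall n : nat, forall u : U, unpickle n = Some u ->
      L x (G u) = \int[K x]_(y in G u) (h (x, y))%:E}.
    apply: ae_foralln => n; case: unpickle => [u|]; last exact: aeW.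
    by apply: filterS (sect _ (mG u)) => x Hx _ [<-].
  apply: filterS2 secU (sect _ measurableT) => x HG HT.
  have h1 : \int[K x]_y (h (x, y))%:E = 1 by rewrite -HT; exact: probability_setT.
  have [m' m'h] := density_probability (fun y => h0 (x, y)) (mhx x) h1.
  move=> B mB; rewrite -m'h//; apply: G_determining => // u.
  by rewrite (HG (pickle u) u) ?pickleK// m'h.
have mE : measurable_fun setT (fun z => (entropy_fun (h z))%:E).
  by apply/measurable_EFinP; apply: measurableT_comp mh; exact: measurable_entropy_fun.
have E0 z : 0 <= (entropy_fun (h z))%:E by rewrite lee_fin entropy_fun_ge0.
rewrite (kullback_density h0 mh Ih) (integral_disintegration mK JK E0 mE).
apply/esym/ae_eq_integral_nonmeasurable.
- by move=> x; apply: integral_ge0 => y _; exact: E0.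
- exact: (measurable_integral_family mK E0 mE).
- apply: filterS dens => x /(kullback_density (fun y => h0 (x, y)) (mhx x)) ->//.
Qed.

End chain_rule.

(** * The product sigma-algebra on real sequences *)

Section sequence_space.
Context (R : realType).

Definition cylinder (n : nat) (B : nat -> set R) : set (nat -> R) :=
  [set y | forall i, (i < n)%N -> B i (y i)].

(** Countably many sets, closed under intersection, generate the product
    sigma-algebra: prescribe rational upper bounds on finitely many initial
    coordinates. The empty sequence gives the whole space. *)
Definition rational_ray (q : seq rat) : set (nat -> R) :=
  cylinder (size q) (fun i => [set r | r < ratr q`_i]).

Lemma measurable_coordinate (i : nat) :
  measurable_fun setT ((fun y => (y : nat -> R) i) : Rseq R -> measurableTypeR R).
Proof.
move=> _ B mB; apply: sub_sigma_algebra.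
by exists i => //; exists B.
Qed.

Lemma cylinderE n (B : nat -> set R) :
  cylinder n B = \bigcap_(i in `I_n) [set y | B i (y i)].
Proof. by apply/seteqP; split. Qed.

Lemma measurable_cylinder n (B : nat -> set (measurableTypeR R)) :
  (forall i, measurable (B i)) -> measurable (cylinder n B : set (Rseq R)).
Proof.
move=> mB; rewrite cylinderE; apply: bigcap_measurableType => i _.
by have := measurable_coordinate i measurableT (mB i); rewrite setTI.
Qed.

Lemma measurable_rational_ray q : measurable (rational_ray q : set (Rseq R)).
Proof.
apply: measurable_cylinder => i.
by rewrite -set_itvNyo; exact: measurable_itv.
Qed.

Lemma rational_ray_setI : setI_closed (range rational_ray).
Proof.
move=> _ _ [p _ <-] [q _ <-].
pose m i : rat := if (i < size p)%N then
  (if (i < size q)%N then Num.min p`_i q`_i else p`_i) else q`_i.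
exists (mkseq m (maxn (size p) (size q))) => //.
rewrite /rational_ray /cylinder size_mkseq; apply/seteqP; split => y /= H.
  split=> i ilt; have := H i; rewrite leq_max ilt ?orbT nth_mkseq ?leq_max ?ilt ?orbT// /m ?ilt.
    case: ifPn => iq /(_ isT)// /lt_le_trans; apply.
    by rewrite ler_rat ge_min lexx.
  case: ifPn => ip /(_ isT)// /lt_le_trans; apply.
  by rewrite ler_rat ge_min lexx orbT.
case: H => Hp Hq i ilt; rewrite nth_mkseq// /m.
case: ifPn => ip; last first.
  by apply: Hq; move: ilt; rewrite leq_max (negbTE ip).
case: ifPn => iq; last exact: Hp.
by rewrite /Num.min; case: ifPn => _; [exact: Hp|exact: Hq].
Qed.

(** The half-space y_i < x is a countable union of rational rays: a rational
    q < x bounds y_i, and a common integer k bounds the preceding coordinates. *)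
Lemma Rseq_measurableE :
  (measurable : set (set (Rseq R))) = <<s range rational_ray >>.
Proof.
apply/seteqP; split; last first.
  apply: smallest_sub; first exact: sigma_algebra_measurable.
  by move=> _ [q _ <-]; exact: measurable_rational_ray.
apply: smallest_sub; first exact: smallest_sigma_algebra.
move=> _ [i _ [B mB <-]].
pose Z : measurableType _ := g_sigma_algebraType (range rational_ray).
suff /(_ measurableT B mB) : measurable_fun setT
  ((fun y => (y : nat -> R) i) : Z -> measurableTypeR R) by [].
apply: (measurability _ (RGenInftyO.measurableE R)) => _ [_ [x ->] <-].
rewrite setTI set_itvNyo.
have -> : (fun y : nat -> R => y i) @^-1` [set r | r < x] =
    \bigcup_(q : rat) \bigcup_(k : nat) [set y : nat -> R |
      ratr q < x /\ rational_ray (rcons (nseq i k%:R) q) y].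
  apply/seteqP; split => [y /= yx|y [q _ [k _ /= [qx]]]]; last first.
    rewrite /rational_ray /cylinder size_rcons size_nseq /= => /(_ i (leqnn _)).
    by rewrite nth_rcons size_nseq ltnn eqxx => /lt_trans; apply.
  have [q /itvP qyx] := rat_in_itvoo yx.
  exists q => //; exists (\sum_(j < i) Num.bound `|y j|)%N => //.
  split; first by rewrite qyx.
  rewrite /rational_ray /cylinder size_rcons size_nseq /= => j.
  rewrite ltnS leq_eqVlt nth_rcons size_nseq => /predU1P[->|ji].
    by rewrite ltnn eqxx qyx.
  rewrite ji nth_nseq ji ratr_nat.
  apply: le_lt_trans (ler_norm _) _; apply: lt_le_trans (archi_boundP _) _ => //.
  by rewrite ler_nat (bigD1 (Ordinal ji))//= leq_addr.
apply: bigcupT_measurable_rat => q; apply: bigcupT_measurable => k.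
have [qx|qx] := pselect (ratr q < x).
  rewrite (_ : [set _ | _] = rational_ray (rcons (nseq i k%:R) q)).
    by apply: sub_sigma_algebra; eexists.
  by apply/seteqP; split => [y []|y].
rewrite (_ : [set _ | _] = set0); first exact: measurable0.
by apply/seteqP; split => [y []|y].
Qed.

Lemma Rseq_measure_unique (m1 m2 : probability (Rseq R) R) :
  (forall q, m1 (rational_ray q) = m2 (rational_ray q)) ->
  forall A, measurable A -> m1 A = m2 A.
Proof.
move=> m12 A mA.
refine (@measure_unique _ R (Rseq R) (range rational_ray) (fun=> setT)
  Rseq_measurableE rational_ray_setI _ _ m1 m2 _ _ _ mA).
- by move=> _; exists [::] => //; apply/seteqP; split.
- by apply/seteqP; split => // y _; exists 0%N.
- by move=> _ [q _ <-]; exact: m12.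
- by move=> _; rewrite [ltLHS](@probability_setT _ _ _ m1) ltry.
Qed.

End sequence_space.

(** * Changing one factor of a product law *)

Lemma ge0_integral_mrestr (R : realType) (d : measure_display)
    (T : measurableType d) (mu : {measure set T -> \bar R}) (C E : set T)
    (mC : measurable C) (f : T -> \bar R) :
  measurable E -> (forall x, 0 <= f x)%E -> measurable_fun setT f ->
  (\int[mrestr mu mC]_(x in E) f x = \int[mu]_(x in E `&` C) f x)%E.
Proof.
move=> mE f0 mf.
rewrite (@ge0_negligible_integral _ _ _ (mrestr mu mC) E (~` C))//; last 3 first.
- exact: measurableC.
- exact: measurable_funTS.
- by rewrite /= /mrestr setICl measure0.
rewrite setDE setCK; apply: eq_measure_integral => A mA AEC.
by rewrite /= /mrestr setIidl// => x /AEC[].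
Qed.

Section product_law.
Context (R : realType).
Implicit Types (mu : probability (Rseq R) R).
Implicit Types (p : nat -> probability (measurableTypeR R) R).
Local Open Scope ereal_scope.

Lemma product_law_eventually mu p (N : nat) :
  (forall n (B : nat -> set (measurableTypeR R)), (N <= n)%N ->
    (forall i, measurable (B i)) ->
    mu (cylinder n B) = \prod_(i < n) p i (B i)) ->
  is_product_law mu p.
Proof.
move=> H n B mB; rewrite -/(cylinder n B).
pose B' i : set (measurableTypeR R) := if (i < n)%N then B i else setT.
have mB' i : measurable (B' i) by rewrite /B'; case: ifP.
have -> : cylinder n B = cylinder (n + N) B'.
  apply/seteqP; split => y By i.
    by rewrite /B' => _; case: ifP => // /By.
  by move=> ilt; have := By i (ltn_addr N ilt); rewrite /B' ilt.
rewrite H ?leq_addl// big_split_ord/= [X in _ * X]big1 ?mule1.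
  by apply: eq_bigr => i _; rewrite /B' ltn_ord.
move=> i _; rewrite /B' ltnNge leq_addr/=; exact: probability_setT.
Qed.

(** With all coordinates but the k-th confined to sets B_i, the law of the k-th
    coordinate under mu is a multiple of [p k]; integrating rho against it
    replaces [p k (B k)] by [p' k (B k)] in the product. *)
Lemma product_law_tilt mu p p' (k : nat) (rho : R -> R) :
  is_product_law mu p ->
  (forall r, (0 <= rho r)%R) ->
  measurable_fun (setT : set (measurableTypeR R)) rho ->
  density_of (p' k) (p k) rho -> (forall i, i != k -> p' i = p i) ->
  exists nu : probability (Rseq R) R, is_product_law nu p' /\
    density_of nu mu (fun y : Rseq R => rho ((y : nat -> R) k)).
Proof.
move=> mup rho0 mrho p'k p'p.
have mck := @measurable_coordinate R k.
have mrhok : measurable_fun setT (fun y : Rseq R => rho ((y : nat -> R) k)).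
  exact: (measurableT_comp mrho mck).
have step n (B : nat -> set (measurableTypeR R)) : (k.+1 <= n)%N ->
    (forall i, measurable (B i)) ->
    \int[mu]_(y in (cylinder n B : set (Rseq R))) (rho ((y : nat -> R) k))%:E =
    \prod_(i < n) p' i (B i).
  move=> kn mB.
  (* The cylinder with its constraint on the coordinate k removed. *)
  pose C : set (Rseq R) := cylinder n (fun i => if i == k then setT else B i).
  have mC : measurable C.
    apply: (@measurable_cylinder R n (fun i => if i == k then setT else B i)) => i.
    by case: ifP.
  have BC D : C `&` (fun y : Rseq R => (y : nat -> R) k) @^-1` D =
      cylinder n (fun i => if i == k then D else B i).
    apply/seteqP; split => [y [Cy Dy] i ilt|y By].
      by have := Cy i ilt; case: eqVneq => // ->.
    split; last by have := By k kn; rewrite eqxx.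
    by move=> i ilt; have := By i ilt; case: eqVneq.
  pose c := \prod_(i < n | i != k :> nat) p i (B i).
  have c_fin : c \is a fin_num.
    apply: (big_ind (fun x : \bar R => x \is a fin_num)) => // [x y|i _].
      exact: fin_numM.
    by apply: fin_num_measure.
  have c0 : 0 <= c by apply: prode_ge0 => i _; exact: measure_ge0.
  have c0' : (0 <= fine c)%R by rewrite fine_ge0.
  have E1 : cylinder n B = (fun y : Rseq R => (y : nat -> R) k) @^-1` (B k) `&` C.
    rewrite setIC BC; congr cylinder; apply/funext => i.
    by case: eqVneq => // ->.
  rewrite E1 -ge0_integral_mrestr//; last 3 first.
    - by rewrite -[X in measurable X]setTI; exact: mck.
    - by move=> y; rewrite lee_fin.
    - exact/measurable_EFinP.
  rewrite -[LHS](@ge0_integral_pushforward _ _ _ _ _ _ mck (mrestr mu mC) (B k)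
    (fun r => (rho r)%:E))//; last 2 first.
    - by apply: measurable_funTS; exact/measurable_EFinP.
    - by move=> r _; rewrite lee_fin.
  rewrite (@eq_measure_integral _ _ _ _ (mscale (NngNum c0') (p k))); last first.
    move=> D mD _; rewrite /= /pushforward /mrestr setIC BC -/(cylinder _ _).
    rewrite [LHS]mup; last by move=> i; case: ifP.
    rewrite (bigD1 (Ordinal kn))//= eqxx /mscale /= muleC fineK//.
    congr (_ * _); apply: eq_big => // i.
    by rewrite -val_eqE /= => /negbTE ->.
  rewrite ge0_integral_mscale//; last 2 first.
    - by apply: measurable_funTS; exact/measurable_EFinP.
    - by move=> r _; rewrite lee_fin.
  rewrite -p'k// /= fineK// [RHS](bigD1 (Ordinal kn))//= muleC.
  congr (_ * _); apply: eq_big => // i ik.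
  by rewrite p'p.
have [nu nu_rho] : exists nu : probability (Rseq R) R,
    density_of nu mu (fun y : Rseq R => rho ((y : nat -> R) k)).
  apply: density_probability => //.
  transitivity (\int[mu]_(y in (cylinder k.+1 (fun=> setT) : set (Rseq R)))
    (rho ((y : nat -> R) k))%:E).
    by congr integral; apply/seteqP; split.
  rewrite step// big1// => i _; exact: probability_setT.
exists nu; split => //; apply: (@product_law_eventually _ _ k.+1) => n B kn mB.
by rewrite nu_rho ?step//; exact: measurable_cylinder.
Qed.

End product_law.

(** * Cameron-Martin shifts of Gaussian product laws *)

Section gaussian.
Context (R : realType).

Lemma normal_prob_shift (m s b : R) : s != 0 ->
  density_of (normal_prob (m + s * b) s) (normal_prob m s)
    (fun y => expR (b * ((y - m) / s) - b ^+ 2 / 2)).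
Proof.
move=> s0 A mA.
rewrite (@ge0_integral_density _ _ _ (normal_prob m s) lebesgue_measure
  (normal_pdf m s))//.
- apply: eq_integral => y _; rewrite -EFinM; congr (_%:E).
  rewrite !normal_pdfE// /normal_fun mulrCA; congr (_ * _).
  by rewrite -expRD; congr expR; rewrite -mulr_natr; field.
- exact: normal_pdf_ge0.
- exact: measurable_normal_pdf.
- apply/measurable_EFinP; apply: measurableT_comp => //.
  apply: measurable_funB => //; apply: measurable_funM => //.
  by apply: measurable_funM => //; apply: measurable_funB.
Qed.

Variable s : R.
Hypothesis s_gt0 : 0 < s.

(** The Gaussian linear statistic sum_(i < n) b_i z_i, where z_i is the i-th
    coordinate standardised by the mean x_i and the standard deviation s. *)
Definition score (x b : nat -> R) (n : nat) (y : Rseq R) : R :=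
  \sum_(i < n) b i * (((y : nat -> R) i - x i) / s).

Lemma measurable_score x b n : measurable_fun setT (score x b n).
Proof.
apply: measurable_sum => i; apply: measurable_funM => //.
apply: measurable_funM => //; apply: measurable_funB => //.
exact: measurable_coordinate.
Qed.

(** The variance of [score] under the Gaussian product law of mean x. *)
Definition energy (b : nat -> R) (n : nat) : R := \sum_(i < n) b i ^+ 2.

Lemma gaussian_tilt (x b : nat -> R) (n : nat) (nu : probability (Rseq R) R) :
  is_product_law nu (fun i => normal_prob (x i) s) ->
  exists nu' : probability (Rseq R) R,
    is_product_law nu' (fun i =>
      normal_prob (if (i < n)%N then x i + s * b i else x i) s) /\
    density_of nu' nu (fun y => expR (score x b n y - energy b n / 2)).
Proof.
move=> nux; elim: n => [|n [nu' [nu'p nu'nu]]].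
  exists nu; split => // A mA.
  under eq_integral do rewrite /score /energy !big_ord0 mul0r subr0 expR0.
  by rewrite integral_cst// mul1e.
pose rho y := expR (b n * ((y - x n) / s) - b n ^+ 2 / 2).
have mrho : measurable_fun (setT : set (measurableTypeR R)) rho.
  apply: measurableT_comp => //.
  apply: measurable_funB => //; apply: measurable_funM => //.
  by apply: measurable_funM => //; apply: measurable_funB.
have [||i ilt|nu2 [nu2p nu2nu]] := @product_law_tilt _ nu' _ (fun i =>
  normal_prob (if (i < n.+1)%N then x i + s * b i else x i) s) n rho nu'p _ mrho.
- by move=> r; rewrite expR_ge0.
- by rewrite ltnSn ltnn; apply: normal_prob_shift; rewrite gt_eqF.
- by rewrite ltnS [in RHS]ltn_neqAle ilt.
exists nu2; split => // A mA; rewrite nu2nu//.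
have mdens : measurable_fun setT (fun y => expR (score x b n y - energy b n / 2)).
  apply: measurableT_comp => //; apply: measurable_funB => //.
  exact: measurable_score.
rewrite (ge0_integral_density _ mdens nu'nu)//; last 2 first.
- by move=> y; rewrite lee_fin expR_ge0.
- apply/measurable_EFinP; apply: (measurableT_comp mrho).
  exact: measurable_coordinate.
apply: eq_integral => y _; rewrite -EFinM; congr (_%:E).
rewrite /rho -expRD; congr expR; rewrite /score /energy !big_ord_recr /=.
by rewrite mulrDl; ring.
Qed.

(** The density of [gaussian_tilt] has total mass 1. *)
Lemma gaussian_exp_moment (x b : nat -> R) (n : nat) (nu : probability (Rseq R) R) :
  is_product_law nu (fun i => normal_prob (x i) s) ->
  (\int[nu]_y (expR (score x b n y))%:E = (expR (energy b n / 2))%:E)%E.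
Proof.
move=> /(gaussian_tilt b n)[nu' [_ /(_ setT measurableT)]].
rewrite [LHS]probability_setT => E1.
transitivity (\int[nu]_y ((expR (energy b n / 2))%:E *
    (expR (score x b n y - energy b n / 2))%:E))%E.
  by apply: eq_integral => y _; rewrite -EFinM -expRD addrC subrK.
rewrite ge0_integralZl//.
- by rewrite -E1 mule1.
- apply/measurable_EFinP; apply: measurableT_comp => //.
  by apply: measurable_funB => //; exact: measurable_score.
Qed.

End gaussian.

(** * First moments from exponential moments *)

Section centred.
Context (R : realType).

(** The right-hand side is of order t^2, so dividing by t and letting t tend to 0
    gives the result. *)
Lemma le0_of_exp_bound (I v : R) : 0 <= v ->
  (forall t, 0 < t -> t * I <= expR (t ^+ 2 * v / 2) - 1) -> I <= 0.
Proof.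
move=> v0 H; rewrite leNgt; apply/negP => I0.
(* Then t = I / c is small enough for e^u <= 1 + 2 u to hold at u = t^2 v / 2,
   and for t v < I. *)
pose c := I + v + 1 + v * I.
have vI : 0 <= v * I by rewrite mulr_ge0// ltW.
have c0 : 0 < c by rewrite /c; lra.
pose t := I / c.
have t0 : 0 < t by rewrite divr_gt0.
have tc : t * c = I by rewrite /t divfK// gt_eqF.
have t1 : t <= 1 by rewrite /t ler_pdivrMr// mul1r /c; lra.
have tv1 : t * v <= 1.
  by rewrite /t mulrAC ler_pdivrMr// mul1r /c (mulrC I v); lra.
have tvI : t * v < I.
  by rewrite -[ltRHS]tc ltr_pM2l// /c; lra.
have tv0 : 0 <= t * v by rewrite mulr_ge0// ltW.
have ttv : t ^+ 2 * v <= 1.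
  by rewrite expr2 -mulrA; apply: le_trans (ler_wpM2r tv0 t1) _; rewrite mul1r.
have ttv0 : 0 <= t ^+ 2 * v by rewrite mulr_ge0// sqr_ge0.
set u := t ^+ 2 * v / 2 in H.
have := H t t0; rewrite -/u.
have u0 : 0 <= u by rewrite /u; lra.
have u2 : u <= 1 / 2 by rewrite /u; lra.
have : expR u * (1 - u) <= 1.
  rewrite -[leRHS]expR0 -(addrN u) expRD ler_wpM2l ?expR_ge0//.
  exact: expR_ge1Dx.
have E1 : 1 <= expR u by rewrite -expR0 ler_expR.
move=> Eu tI.
have : expR u - 1 <= 2 * u by nra.
have -> : 2 * u = t * (t * v) by rewrite /u; field.
move=> /(le_trans tI); rewrite ler_pM2l// leNgt.
by rewrite tvI.
Qed.

Context (d : measure_display) (T : measurableType d).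
Local Open Scope ereal_scope.

(** A variable whose exponential moments are those of N(0, v) has mean 0, here
    under the measure of density w: integrating t W <= e^(t W) - 1 bounds the
    mean by O(t), for both signs of t. *)
Lemma integral_exp_moment_centred (mu : {measure set T -> \bar R})
    (w W : T -> R) (v : R) :
  (0 <= v)%R -> (forall x, (0 <= w x)%R) ->
  measurable_fun setT w -> measurable_fun setT W ->
  (forall t : R, \int[mu]_x (w x * expR (t * W x))%:E = (expR (t ^+ 2 * v / 2))%:E) ->
  mu.-integrable setT (fun x => (w x * W x)%:E) /\
  \int[mu]_x (w x * W x)%:E = 0.
Proof.
move=> v0 w0 mw mW H.
have mexp t : measurable_fun setT (fun x => (w x * expR (t * W x))%R).
  by apply: measurable_funM => //; apply: measurableT_comp => //; exact: measurable_funM.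
have iexp t : mu.-integrable setT (fun x => (w x * expR (t * W x))%:E).
  apply/integrableP; split; first exact/measurable_EFinP.
  under eq_integral do rewrite gee0_abs ?lee_fin ?mulr_ge0 ?expR_ge0//.
  by rewrite H ltry.
have mwW : measurable_fun setT (fun x => (w x * W x)%R) by exact: measurable_funM.
have iwW : mu.-integrable setT (fun x => (w x * W x)%:E).
  apply: (@le_integrable _ _ _ mu setT measurableT _
    (fun x => (w x * expR (1 * W x))%:E + (w x * expR (- 1 * W x))%:E)).
  - exact/measurable_EFinP.
  - move=> x _; rewrite -EFinD !abse_EFin lee_fin -mulrDr !normrM.
    rewrite ler_wpM2l// mul1r mulN1r [leRHS]ger0_norm; last by rewrite addr_ge0 ?expR_ge0.
    have := expR_ge1Dx (W x); have := expR_ge1Dx (- W x).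
    have := expR_ge0 (W x); have := expR_ge0 (- W x).
    by rewrite ler_norml; lra.
  - exact: integrableD.
split => //.
have Ifin := integrable_fin_num measurableT iwW.
rewrite -(fineK Ifin); congr (_%:E).
have w1 : \int[mu]_x (w x)%:E = 1.
  by have := H 0%R; under eq_integral do rewrite mul0r expR0 mulr1;
     rewrite expr0n/= mul0r mul0r expR0.
have iw : mu.-integrable setT (EFin \o w).
  have := iexp 0%R; apply: eq_integrable => // x _.
  by rewrite mul0r expR0 mulr1.
have bound t : (t * fine (\int[mu]_x (w x * W x)%:E) <= expR (t ^+ 2 * v / 2) - 1)%R.
  rewrite -lee_fin EFinM fineK// -integralZl// EFinB -H -w1.
  rewrite -integralB//.
  apply: le_integral => //; [exact: integrableZl|exact: integrableB|].
  move=> x _; rewrite -EFinM -EFinB lee_fin.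
  have := expR_ge1Dx (t * W x); have := w0 x; nra.
apply/eqP; rewrite eq_le; apply/andP; split.
  by apply: (le0_of_exp_bound v0) => t _; exact: bound.
rewrite -oppr_le0; apply: (le0_of_exp_bound v0) => t _.
by have := bound (- t)%R; rewrite sqrrN mulNr mulrN.
Qed.

End centred.

(** * Lower semicontinuity of the entropy integrand *)

Section entropy_lsc.
Context (R : realType).
Local Open Scope ereal_scope.

(** By [entropy_fun_tangent], [entropy_fun] is a supremum of affine functions,
    hence lower semicontinuous. At l = 0 the supremum is only approached, as
    h tends to -oo. *)
Lemma entropy_fun_lsc (u : nat -> R) (l : R) :
  (forall n, (0 <= u n)%R) -> u @ \oo --> l ->
  (entropy_fun l)%:E <= limn_einf (fun n => (entropy_fun (u n))%:E).
Proof.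
move=> u0 ul.
have l0 : (0 <= l)%R.
  rewrite -(cvg_lim (@Rhausdorff R) ul); apply: limr_ge; first exact: cvgP ul.
  exact: nearW.
have bound (h : R) : (l * h - expR h + 1)%:E <=
    limn_einf (fun n => (entropy_fun (u n))%:E).
  have cvgh : ((u n * h - expR h + 1)%:E @[n --> \oo] --> (l * h - expR h + 1)%:E).
    apply: cvg_EFin; first exact: nearW.
    rewrite /comp/=; apply: (@cvgD _ R^o); last exact: cvg_cst.
    apply: (@cvgB _ R^o); last exact: cvg_cst.
    by apply: cvgM => //; exact: cvg_cst.
  rewrite -(cvg_lim (@ereal_hausdorff R) cvgh) -is_cvg_limn_einfE; last exact: cvgP cvgh.
  rewrite !limn_einf_lim; apply: lee_lim; [exact: is_cvg_einfs|exact: is_cvg_einfs|].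
  apply: nearW => n; apply: le_ereal_inf_tmp => _ [m /= nm <-].
  apply: (@le_trans _ _ (u m * h - expR h + 1)%:E).
    by apply: ereal_inf_lbound; exists m.
  by rewrite lee_fin; exact: entropy_fun_tangent.
move: l0; rewrite le_eqVlt => /predU1P[l0|l0].
  apply/lee_addgt0Pr => e e0; rewrite -leeBlDr//.
  apply: le_trans (bound (ln e)).
  by rewrite -EFinB lee_fin /entropy_fun -l0 !mul0r lnK ?posrE//; lra.
apply: le_trans (bound (ln l)).
by rewrite lnK ?posrE.
Qed.

End entropy_lsc.

(** * Likelihood ratios of finite shifts *)

Section likelihood_ratio.
Context (R : realType) (s : R) (s_gt0 : 0 < s).

Lemma score_scale (x b : nat -> R) (t : R) n y :
  score s x (fun i => t * b i) n y = t * score s x b n y.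
Proof. by rewrite /score mulr_sumr; apply: eq_bigr => i _; ring. Qed.

Lemma energy_scale (b : nat -> R) (t : R) n :
  energy (fun i => t * b i) n = t ^+ 2 * energy b n.
Proof. by rewrite /energy mulr_sumr; apply: eq_bigr => i _; rewrite exprMn. Qed.

Lemma energy_ge0 (b : nat -> R) n : 0 <= energy b n.
Proof. by apply: sumr_ge0 => i _; exact: sqr_ge0. Qed.

Lemma energy_nondecreasing (b : nat -> R) :
  {homo energy b : n m / (n <= m)%N >-> n <= m}.
Proof.
apply: homo_leq => [//|u v w|n]; first exact: le_trans.
by rewrite /energy big_ord_recr/= lerDl sqr_ge0.
Qed.

(** The density of [gaussian_tilt]. *)
Definition likelihood_ratio (x b : nat -> R) n (y : Rseq R) : R :=
  expR (score s x b n y - energy b n / 2).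

Lemma likelihood_ratio_ge0 x b n y : 0 <= likelihood_ratio x b n y.
Proof. exact: expR_ge0. Qed.

Lemma measurable_likelihood_ratio x b n : measurable_fun setT (likelihood_ratio x b n).
Proof.
apply: measurableT_comp => //; apply: measurable_funB => //.
exact: measurable_score.
Qed.

Variables (x : nat -> R) (nu : probability (Rseq R) R).
Hypothesis nux : is_product_law nu (fun i => normal_prob (x i) s).
Local Open Scope ereal_scope.

Lemma integral_expR_shift (b : nat -> R) n (a : R) :
  \int[nu]_y (expR (score s x b n y + a))%:E = (expR (energy b n / 2 + a))%:E.
Proof.
under eq_integral do rewrite expRD mulrC EFinM.
rewrite ge0_integralZl//; last first.
  apply/measurable_EFinP; apply: measurableT_comp => //; exact: measurable_score.
by rewrite gaussian_exp_moment// -EFinM -expRD addrC.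
Qed.

Lemma integral_likelihood_ratio b n : \int[nu]_y (likelihood_ratio x b n y)%:E = 1.
Proof. by rewrite integral_expR_shift subrr expR0. Qed.

(** The product of two ratios is, up to a constant factor, the ratio attached to
    the shift c which is 2 b on the first n coordinates and b on the next ones.
    *)
Lemma integral_likelihood_ratioM b n m : (n <= m)%N ->
  \int[nu]_y (likelihood_ratio x b n y * likelihood_ratio x b m y)%:E = (expR (energy b n))%:E.
Proof.
move=> nm; pose c i : R := (if (i < n)%N then 2 * b i else b i)%R.
have Es y : score s x c m y = (score s x b n y + score s x b m y)%R.
  rewrite /score (big_ord_widen _ (fun i => b i * (((y : nat -> R) i - x i) / s))%R nm).
  rewrite [X in _ = (X + _)%R]big_mkcond/= -big_split/=; apply: eq_bigr => i _; rewrite /c.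
  by case: ifP => _; ring.
have Ee : energy c m = (3 * energy b n + energy b m)%R.
  rewrite /energy (big_ord_widen _ (fun i => b i ^+ 2)%R nm).
  rewrite mulr_sumr [X in _ = (X + _)%R]big_mkcond/= -big_split/=.
  by apply: eq_bigr => i _; rewrite /c; case: ifP => _; ring.
transitivity (\int[nu]_y (expR (score s x c m y +
    (- (energy b n / 2) - energy b m / 2)))%:E).
  by apply: eq_integral => y _; rewrite /likelihood_ratio -expRD Es; congr (expR _)%:E; ring.
by rewrite integral_expR_shift Ee; congr (expR _)%:E; field.
Qed.

Lemma integral_likelihood_ratioB b n m : (n <= m)%N ->
  \int[nu]_y ((likelihood_ratio x b m y - likelihood_ratio x b n y) ^+ 2)%:E =
  (expR (energy b m) - expR (energy b n))%:E.
Proof.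
move=> nm.
have mF := measurable_likelihood_ratio x b.
have mFF k l : measurable_fun setT (fun y => likelihood_ratio x b k y * likelihood_ratio x b l y)%R.
  exact: measurable_funM.
have mFB : measurable_fun setT (fun y =>
    (likelihood_ratio x b m y - likelihood_ratio x b n y) ^+ 2)%R.
  by apply: measurable_funX; exact: measurable_funB.
have : \int[nu]_y (((likelihood_ratio x b m y - likelihood_ratio x b n y) ^+ 2)%:E +
    (likelihood_ratio x b n y * likelihood_ratio x b m y +
     likelihood_ratio x b n y * likelihood_ratio x b m y)%:E) =
  \int[nu]_y ((likelihood_ratio x b m y * likelihood_ratio x b m y)%:E +
    (likelihood_ratio x b n y * likelihood_ratio x b n y)%:E).
  by apply: eq_integral => y _; rewrite -!EFinD; congr (_%:E); ring.
have FF0 k l y : 0 <= (likelihood_ratio x b k y * likelihood_ratio x b l y)%:E.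
  by rewrite lee_fin mulr_ge0// likelihood_ratio_ge0.
rewrite [RHS]ge0_integralD//; [|exact/measurable_EFinP..].
rewrite !integral_likelihood_ratioM//.
rewrite ge0_integralD//; last 4 first.
- by move=> y _; rewrite lee_fin sqr_ge0.
- exact/measurable_EFinP.
- by move=> y _; rewrite EFinD adde_ge0.
- by apply/measurable_EFinP; exact: measurable_funD.
under [X in _ + X]eq_integral do rewrite EFinD.
rewrite [X in _ + X]ge0_integralD//; [|exact/measurable_EFinP..].
rewrite integral_likelihood_ratioM// -!EFinD.
move=> /(congr1 (fun z => z - (expR (energy b n) + expR (energy b n))%:E)).
by rewrite addeK// -EFinB => ->; congr (_%:E); ring.
Qed.

End likelihood_ratio.

(** * Equivalence of two Gaussian product laws *)

Section equivalent_gaussians.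
Context (R : realType) (s : R) (s_gt0 : 0 < s).
Local Open Scope ereal_scope.

Lemma cylinder_likelihood_ratio (x m : nat -> R) (nu mu : probability (Rseq R) R)
    (n k : nat) (B : nat -> set (measurableTypeR R)) :
  is_product_law nu (fun i => normal_prob (x i) s) ->
  is_product_law mu (fun i => normal_prob (m i) s) ->
  (n <= k)%N -> (forall i, measurable (B i)) ->
  \int[nu]_(y in (cylinder n B : set (Rseq R)))
    (likelihood_ratio s x (fun i => (m i - x i) / s)%R k y)%:E = mu (cylinder n B).
Proof.
move=> nux mum nk mB.
have [nu' [nu'p nu'nu]] := gaussian_tilt s_gt0 (fun i => (m i - x i) / s)%R k nux.
rewrite -nu'nu; last exact: measurable_cylinder.
rewrite [LHS]nu'p// [RHS]mum//; apply: eq_bigr => i _.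
rewrite (leq_trans (ltn_ord i) nk) mulrCA mulfV ?gt_eqF// mulr1.
by rewrite addrC subrK.
Qed.

(** The divergence of a shift of finitely many coordinates. Under the law with
    density the ratio itself, [score] has mean [energy], as
    [integral_exp_moment_centred] shows. *)
Lemma integral_entropy_likelihood_ratio (x b : nat -> R) (n : nat)
    (nu : probability (Rseq R) R) :
  is_product_law nu (fun i => normal_prob (x i) s) ->
  \int[nu]_y (entropy_fun (likelihood_ratio s x b n y))%:E = (energy b n / 2)%:E.
Proof.
move=> nux; set e := energy b n.
pose W y := (score s x b n y - e)%R.
have mW : measurable_fun setT W.
  by apply: measurable_funB => //; exact: measurable_score.
have ml := @measurable_likelihood_ratio R s x b n.
have l1 := integral_likelihood_ratio s_gt0 nux b n.
have [] := @integral_exp_moment_centred R _ _ nu (likelihood_ratio s x b n) W e (energy_ge0 b n)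
   (@likelihood_ratio_ge0 R s x b n) ml mW.
  move=> t.
  transitivity (\int[nu]_y (expR (score s x (fun i => (1 + t) * b i)%R n y
      + (- (e / 2) - t * e))%R)%:E).
    apply: eq_integral => y _; rewrite /likelihood_ratio -expRD score_scale -/e /W.
    by congr (expR _)%:E; ring.
  by rewrite (integral_expR_shift s_gt0 nux) energy_scale -/e; congr (expR _)%:E; field.
move=> iW W0.
have il : nu.-integrable setT (fun y => (likelihood_ratio s x b n y)%:E).
  apply/integrableP; split; first exact/measurable_EFinP.
  by under eq_integral do rewrite gee0_abs ?lee_fin ?likelihood_ratio_ge0//; rewrite l1 ltry.
transitivity (\int[nu]_y ((likelihood_ratio s x b n y * W y)%:E +
  ((e / 2 - 1)%:E * (likelihood_ratio s x b n y)%:E + cst 1 y))).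
  apply: eq_integral => y _; rewrite /entropy_fun {2}/likelihood_ratio expRK -/e.
  by rewrite -EFinM -!EFinD; congr (_%:E); rewrite /W; field.
rewrite integralD//; last first.
  by apply: integrableD => //; [exact: integrableZl|exact: finite_measure_integrable_cst].
rewrite integralD//; [|exact: integrableZl|exact: finite_measure_integrable_cst].
rewrite integralZl// W0 l1 integral_cst// [X in _ + (_ + _ * X)](@probability_setT _ _ _ nu).
by rewrite add0e !mule1 -EFinD subrK.
Qed.

(** The data processing inequality for the first n coordinates, from
    [entropy_fun_tangent] with h the logarithm of the n-th likelihood ratio:
    under mu, the score relative to nu is the score W relative to mu, which is
    centred, plus the energy. *)
Lemma entropy_density_ge (x m : nat -> R) (nu mu : probability (Rseq R) R)
    (f : Rseq R -> R) (n : nat) :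
  let b i := ((m i - x i) / s)%R in
  is_product_law nu (fun i => normal_prob (x i) s) ->
  is_product_law mu (fun i => normal_prob (m i) s) ->
  (forall y, (0 <= f y)%R) -> measurable_fun setT f -> density_of mu nu f ->
  nu.-integrable setT (fun y => (entropy_fun (f y))%:E) ->
  (energy b n / 2)%:E <= \int[nu]_y (entropy_fun (f y))%:E.
Proof.
move=> b nux mum f0 mf muf ientf.
have iff := density_integrable f0 mf muf.
have f1 : \int[nu]_y (f y)%:E = 1.
  by rewrite -(muf _ measurableT); exact: probability_setT.
set e := energy b n.
pose W := score s m b n.
have mW : measurable_fun setT W by exact: measurable_score.
have [] := @integral_exp_moment_centred R _ _ nu f W e (energy_ge0 b n) f0 mf mW.
  move=> t; under eq_integral do rewrite EFinM muleC.
  rewrite -(ge0_integral_density f0 mf muf)//; last first.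
    by apply/measurable_EFinP; apply: measurableT_comp => //; exact: measurable_funM.
  under eq_integral do rewrite -score_scale.
  by rewrite (gaussian_exp_moment s_gt0 _ _ mum) energy_scale.
move=> iW W0.
have il : nu.-integrable setT (fun y => (likelihood_ratio s x b n y)%:E).
  apply/integrableP; split; first by apply/measurable_EFinP; exact: measurable_likelihood_ratio.
  under eq_integral do rewrite gee0_abs ?lee_fin ?likelihood_ratio_ge0//.
  by rewrite integral_likelihood_ratio// ltry.
have i1 : nu.-integrable setT (cst 1) by exact: finite_measure_integrable_cst.
have i2 : nu.-integrable setT (fun y => (e / 2)%:E * (f y)%:E) by exact: integrableZl.
pose h y := (f y * W y)%:E + ((e / 2)%:E * (f y)%:E + (cst 1 y - (likelihood_ratio s x b n y)%:E)).
have i3 : nu.-integrable setT (fun y => cst 1 y - (likelihood_ratio s x b n y)%:E).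
  exact: integrableB.
have i4 : nu.-integrable setT (fun y => (e / 2)%:E * (f y)%:E +
  (cst 1 y - (likelihood_ratio s x b n y)%:E)) by exact: integrableD.
have ih : nu.-integrable setT h by exact: integrableD.
apply: (@le_trans _ _ (\int[nu]_y h y)).
  rewrite /h integralD// integralD// integralB// integralZl// W0 f1.
  rewrite integral_likelihood_ratio// integral_cst// [X in _ * X - _](@probability_setT _ _ _ nu).
  by rewrite !mule1 subee// adde0 add0e.
apply: le_integral => // y _; rewrite /h -EFinB -EFinM -!EFinD lee_fin /likelihood_ratio -/e.
apply: le_trans (entropy_fun_tangent (score s x b n y - e / 2)%R (f0 y)).
have -> : (score s x b n y = W y + e)%R.
  rewrite /W /score /e /energy -big_split /=; apply: eq_bigr => i _.
  by rewrite /b; field; rewrite gt_eqF.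
by rewrite le_eqVlt; apply/orP; left; apply/eqP; field.
Qed.

(** The likelihood ratios along a subsequence k with
    e^A - e^(energy b (k j)) <= 4^(-j) satisfy the hypotheses of [fast_L1_cvg]. *)
Theorem gaussian_density (x m : nat -> R) (nu mu : probability (Rseq R) R)
    (A : R) :
  is_product_law nu (fun i => normal_prob (x i) s) ->
  is_product_law mu (fun i => normal_prob (m i) s) ->
  energy (fun i => (m i - x i) / s)%R @ \oo --> A ->
  exists f : Rseq R -> R, [/\ forall y, (0 <= f y)%R, measurable_fun setT f,
    density_of mu nu f & \int[nu]_y (entropy_fun (f y))%:E = (A / 2)%:E].
Proof.
move=> nux mum; set b := (fun i => _) => bA.
have bleA n : (energy b n <= A)%R.
  rewrite -(cvg_lim (@Rhausdorff R) bA).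
  by apply: nondecreasing_cvgn_le; [exact: energy_nondecreasing|exact: cvgP bA].
have /choice[N HN] : forall j, exists K : nat, forall n, (K <= n)%N ->
    (expR A - expR (energy b n) <= (2^-1 ^+ j) ^+ 2)%R.
  move=> j.
  have : expR (energy b n) @[n --> \oo] --> expR A.
    apply: (@cvg_comp _ _ _ (energy b) (@expR R) _ _ _ bA); exact: continuous_expR.
  move=> /cvgrPdist_le/(_ ((2^-1 ^+ j) ^+ 2)%R) [|K _ HK].
    by rewrite !exprn_gt0// invr_gt0.
  by exists K => n /HK /=; apply: le_trans; exact: ler_norm.
(* A sum, so that k is nondecreasing and k j bounds both N j and j. *)
pose k j := (\sum_(i < j.+1) (N i).+1)%N.
have kS j : (k j <= k j.+1)%N by rewrite /k [leqRHS]big_ord_recr/= leq_addr.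
have Nk j : (N j <= k j)%N.
  by rewrite /k big_ord_recr/= (leq_trans (leqnSn _)) ?leq_addl.
have jk j : (j <= k j)%N.
  elim: j => // j IH; rewrite /k big_ord_recr/= -/(k j) addnS ltnS.
  by rewrite (leq_trans IH)// leq_addr.
pose g j := likelihood_ratio s x b (k j).
have mg j : measurable_fun setT (g j) by exact: measurable_likelihood_ratio.
have g0 j y : (0 <= g j y)%R by exact: likelihood_ratio_ge0.
have g1 j : \int[nu]_y (g j y)%:E = 1 by exact: integral_likelihood_ratio.
have [||||f [f0 mf gf intgf]] := @fast_L1_cvg R _ (Rseq R) nu g.
- exact: g0.
- exact: mg.
- apply/integrableP; split; first exact/measurable_EFinP.
  by under eq_integral do rewrite /= ger0_norm//; rewrite g1 ltry.
- move=> j; apply: (integral_norm_le_sqr).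
  + by rewrite exprn_gt0// invr_gt0.
  + exact: measurable_funB.
  + rewrite integral_likelihood_ratioB// lee_fin; apply: le_trans (HN j (k j) (Nk j)).
    by rewrite lerD2r ler_expR.
have fray q : mu (rational_ray q) = \int[nu]_(y in (rational_ray q : set (Rseq R))) (f y)%:E.
  apply/esym; rewrite -(cvg_lim (@ereal_hausdorff R) (intgf _ (@measurable_rational_ray R q))).
  apply: cvg_lim => //.
  apply: cvg_near_cst; near=> j.
  apply: (cylinder_likelihood_ratio nux mum) => [|i].
    by apply: leq_trans (jk j); near: j; exact: nbhs_infty_ge.
  by rewrite -set_itvNyo; exact: measurable_itv.
have f1 : \int[nu]_y (f y)%:E = 1.
  have := fray [::]; rewrite (_ : rational_ray [::] = setT); last first.
    by apply/seteqP; split.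
  by move=> <-; exact: probability_setT.
have [mu' mu'f] := density_probability f0 mf f1.
have muf : density_of mu nu f.
  move=> D mD; rewrite -mu'f//; apply: Rseq_measure_unique => // q.
  by rewrite fray mu'f//; exact: measurable_rational_ray.
have mentf : measurable_fun setT (fun y => (entropy_fun (f y))%:E).
  by apply/measurable_EFinP; apply: measurableT_comp mf; exact: measurable_entropy_fun.
have entf0 y : 0 <= (entropy_fun (f y))%:E by rewrite lee_fin entropy_fun_ge0.
have mentg j : measurable_fun setT (fun y => (entropy_fun (g j y))%:E).
  by apply/measurable_EFinP; apply: measurableT_comp (mg j); exact: measurable_entropy_fun.
have entg0 j y : 0 <= (entropy_fun (g j y))%:E by rewrite lee_fin entropy_fun_ge0.
have up : \int[nu]_y (entropy_fun (f y))%:E <= (A / 2)%:E.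
  apply: (@le_trans _ _ (\int[nu]_y limn_einf (fun j => (entropy_fun (g j y))%:E))).
    apply: ae_ge0_le_integral => //.
    - move=> y _; rewrite limn_einf_lim; apply: lime_ge; first exact: is_cvg_einfs.
      by apply: nearW => n; apply: le_ereal_inf_tmp => _ [p _ <-].
    - rewrite /limn_einf; apply: measurableT_comp => //.
      by apply: measurable_fun_limn_esup => j; exact: measurableT_comp.
    - by apply: filterS gf => y gfy _; exact: entropy_fun_lsc.
  apply: (le_trans (fatou nu measurableT mentg (fun n y _ => entg0 n y))).
  rewrite limn_einf_lim; apply: lime_le; first exact: is_cvg_einfs.
  apply: nearW => n; apply: (@le_trans _ _ (\int[nu]_y (entropy_fun (g n y))%:E)).
    by apply: ereal_inf_lbound; exists n => /=.
  by rewrite integral_entropy_likelihood_ratio// lee_fin ler_pM2r.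
have ientf : nu.-integrable setT (fun y => (entropy_fun (f y))%:E).
  apply/integrableP; split => //.
  by under eq_integral do rewrite gee0_abs//; rewrite (le_lt_trans up)// ltry.
have low n : (energy b n / 2)%:E <= \int[nu]_y (entropy_fun (f y))%:E.
  exact: entropy_density_ge nux mum f0 mf muf ientf.
exists f; split => //; apply/eqP; rewrite eq_le up/=.
have e2A : (energy b n / 2)%:E @[n --> \oo] --> (A / 2)%:E.
  by apply: cvg_EFin; [exact: nearW|apply: cvgM => //; exact: cvg_cst].
rewrite -(cvg_lim (@ereal_hausdorff R) e2A); apply: lime_le; first exact: cvgP e2A.
exact: nearW.
Unshelve. all: by end_near.
Qed.

End equivalent_gaussians.

(** * Parseval's identity and nearest centres *)

Section hilbert.
Context (R : realType) (H : completeNormedModType R) (dot : {dot H for idfun}).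

Lemma dotC (u v : H) : dot u v = dot v u.
Proof. by rewrite hermC/= expr0 mul1r. Qed.

Lemma dotBl (u v w : H) : dot (u - v) w = dot u w - dot v w.
Proof. exact: linearBl. Qed.

Lemma dot_suml n (a : nat -> R) (e : nat -> H) (w : H) :
  dot (\sum_(i < n) a i *: e i) w = \sum_(i < n) a i * dot (e i) w.
Proof.
by rewrite linear_sumlz; apply: eq_bigr => i _; rewrite linearZl_LR.
Qed.

Hypothesis norm_dot : forall x : H, `|x| ^+ 2 = dot x x.
Variables (e : nat -> H).
Hypothesis e_orthonormal : forall i j, dot (e i) (e j) = (i == j)%:R.

(** Pythagoras: among the combinations of the first n vectors, the one with
    coefficients <v, e_i> is nearest to v. *)
Lemma norm_sub_span (v : H) n (a : nat -> R) :
  `|v - \sum_(i < n) a i *: e i| ^+ 2 =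
  `|v| ^+ 2 - \sum_(i < n) dot v (e i) ^+ 2 + \sum_(i < n) (dot v (e i) - a i) ^+ 2.
Proof.
set w := \sum_(i < n) _.
have dotwe (i : 'I_n) : dot w (e i) = a i.
  rewrite dot_suml (bigD1 i)//= e_orthonormal eqxx mulr1 big1 ?addr0// => j ji.
  by rewrite e_orthonormal (negbTE ji : (j == i :> nat) = false) mulr0.
have dotwv : dot w v = \sum_(i < n) a i * dot v (e i).
  by rewrite dot_suml; apply: eq_bigr => i _; rewrite dotC.
have dotww : dot w w = \sum_(i < n) a i * a i.
  by rewrite {1}/w dot_suml; apply: eq_bigr => i _; rewrite dotC dotwe.
rewrite !norm_dot dotBl (dotC v) (dotC w) !dotBl (dotC v w) dotwv dotww.
have -> : \sum_(i < n) (dot v (e i) - a i) ^+ 2 = \sum_(i < n) dot v (e i) ^+ 2 +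
    (\sum_(i < n) a i * a i - 2 * \sum_(i < n) a i * dot v (e i)).
  rewrite mulr_sumr -sumrB -big_split/=; apply: eq_bigr => i _; ring.
ring.
Qed.

End hilbert.

Section parseval.
Context (R : realType) (H : completeNormedModType R) (dot : {dot H for idfun}).
Hypothesis norm_dot : forall x : H, `|x| ^+ 2 = dot x x.
Variables (e : nat -> H).
Hypothesis e_basis : orthonormal_basis dot e.

(** Density of the span provides combinations a arbitrarily close to v, and
    [norm_sub_span] bounds |v|^2 - sum_(i < n) <v, e_i>^2 by the squared distance
    to any of them. *)
Lemma parseval (v : H) :
  (\sum_(i < n) dot v (e i) ^+ 2) @[n --> \oo] --> `|v| ^+ 2.
Proof.
have [e1 e_dense] := e_basis.
apply/cvgrPdist_le => eps eps0.
have [w [/= vw [n [a wE]]]] : (ball v (Num.sqrt eps) `&`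
    [set x : H | exists n (a : nat -> R), x = \sum_(i < n) a i *: e i]) !=set0.
  apply: e_dense; last exact: ball_open.
  by exists v; apply: ballxx; rewrite sqrtr_gt0.
have mono := @homo_leq _ (fun n => \sum_(i < n) dot v (e i) ^+ 2) (fun x y => x <= y).
exists n => // m /= nm.
have nonneg : 0 <= `|v| ^+ 2 - \sum_(i < m) dot v (e i) ^+ 2.
  have := norm_sub_span norm_dot e1 v m (fun i => dot v (e i)).
  rewrite [X in _ = _ + X]big1 ?addr0; last by move=> i _; rewrite subrr expr0n.
  by move=> <-; exact: sqr_ge0.
rewrite ger0_norm//.
apply: (@le_trans _ _ (`|v| ^+ 2 - \sum_(i < n) dot v (e i) ^+ 2)).
  rewrite lerD2l lerN2; apply: mono nm => // [y x z|k]; first exact: le_trans.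
  by rewrite big_ord_recr/= lerDl sqr_ge0.
have := norm_sub_span norm_dot e1 v n a; rewrite -wE => vwE.
have : `|v - w| ^+ 2 <= eps.
  rewrite -[leRHS]sqr_sqrtr ?(ltW eps0)// lerXn2r ?nnegrE ?sqrtr_ge0//.
  by move: vw; rewrite -ball_normE /= => /ltW.
rewrite vwE; apply: le_trans; rewrite lerDl; apply: sumr_ge0 => i _; exact: sqr_ge0.
Qed.

End parseval.

Section kmeans.
Context (R : realType) (H : completeNormedModType R) (k : nat) (c : 'I_k.+1 -> H).

Lemma ell_argmin (x : H) (i : 'I_k.+1) : `|x - c (ell c x)| <= `|x - c i|.
Proof.
rewrite /ell; case: arg_minnP => [|j]; rewrite inE; last first.
  by move=> /forallP/(_ i).
by apply/forallP => j; case: arg_minP => // l _ /(_ j); exact.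
Qed.

Lemma min_sqr_dist (x : H) :
  \big[Num.min/`|x - c ord0| ^+ 2]_(j < k.+1) `|x - c j| ^+ 2 =
  `|x - c (ell c x)| ^+ 2.
Proof.
apply/eqP; rewrite eq_le; apply/andP; split; first exact: bigmin_le.
by apply: le_bigmin => [|i _]; rewrite lerXn2r ?nnegrE// ell_argmin.
Qed.

Lemma measurable_min_sqr_dist : measurable_fun setT (fun x : borel H =>
  \big[Num.min/`|(x : H) - c ord0| ^+ 2]_(j < k.+1) `|(x : H) - c j| ^+ 2).
Proof.
have mdist j : measurable_fun (setT : set (borel H)) (fun x : borel H => `|(x : H) - c j| ^+ 2).
  have cdist : continuous (fun x : H => `|x - c j| ^+ 2).
    move=> x; apply: cvgM; apply: cvg_norm; apply: cvgB => //; exact: cvg_cst.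
  apply: (measurability _ (RGenInftyO.measurableE R)) => _ [_ [r ->] <-].
  rewrite setTI; apply: sub_sigma_algebra.
  move/continuousP: cdist; apply; exact: interval_open.
elim: (index_enum _) => [|j r IH].
  by under eq_fun do rewrite big_nil; exact: mdist.
by under eq_fun do rewrite big_cons; apply: measurable_minr.
Qed.

End kmeans.

(** * The k-means criterion *)

(** The Cameron-Martin formula: by Parseval's identity, the energy of the shift
    from x to m converges to |x - m|^2 / sigma^2. *)
Lemma gaussian_law_kullback (R : realType) (H : completeNormedModType R)
    (dot : {dot H for idfun}) (norm_dot : forall x : H, `|x| ^+ 2 = dot x x)
    (e : nat -> H) (e_basis : orthonormal_basis dot e) (sigma : R) (x m : H)
    (K L : probability (Rseq R) R) :
  0 < sigma -> gaussian_law dot e sigma x K -> gaussian_law dot e sigma m L ->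
  L `<< K /\ kullback L K = (`|x - m| ^+ 2 / (2 * sigma ^+ 2))%:E.
Proof.
move=> sigma0 Kx Lm.
have cvgE : energy (fun i => (dot m (e i) - dot x (e i)) / sigma) @ \oo -->
    `|x - m| ^+ 2 / sigma ^+ 2.
  rewrite (_ : energy _ = (fun n => (\sum_(i < n) dot (x - m) (e i) ^+ 2) / sigma ^+ 2)).
    by apply: cvgM; [exact: parseval|exact: cvg_cst].
  apply/funext => n; rewrite mulr_suml; apply: eq_bigr => i _.
  by rewrite dotBl exprMn exprVn -sqrrN opprB.
have [f [f0 mf Lf fE]] := gaussian_density sigma0 Kx Lm cvgE.
split; first exact: density_dominates Lf.
rewrite (kullback_density f0 mf Lf) fE; congr (_%:E).
by field; rewrite gt_eqF.
Qed.

Theorem proposition2 (R : realType) (H : completeNormedModType R)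
  (dot : {dot H for idfun}) (norm_dot : forall x : H, `|x| ^+ 2 = dot x x)
  (e : nat -> H) (e_basis : orthonormal_basis dot e)
  (sigma : R) (sigma_gt0 : 0 < sigma)
  (d : measure_display) (T : measurableType d)
  (X : {mfun T >-> borel H}) (Y : {mfun T >-> Rseq R})
  (P : probability T R) (PYX : borel H -> probability (Rseq R) R)
  (PYX_law : conditional_law P X Y PYX)
  (PYX_gauss : {ae distribution P X, forall x,
     gaussian_law dot e sigma x (PYX x)})
  (k : nat) (c : 'I_k.+1 -> H)
  (Q : probability T R) (QYX : borel H -> probability (Rseq R) R)
  (QX : forall A : set (borel H), measurable A ->
     distribution Q X A = distribution P X A)
  (QYX_law : conditional_law Q X Y QYX)
  (QYX_gauss : {ae distribution Q X, forall x,
     gaussian_law dot e sigma (c (ell c x)) (QYX x)}) :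
  kmeans_risk (distribution P X) c =
    ((2 * sigma ^+ 2)%:E *
       \int[distribution P X]_x kullback (QYX x) (PYX x))%E /\
  ((2 * sigma ^+ 2)%:E *
       \int[distribution P X]_x kullback (QYX x) (PYX x))%E =
    ((2 * sigma ^+ 2)%:E *
       kullback (distribution Q (joint X Y)) (distribution P (joint X Y)))%E.
Proof.
have [mPYX PYX_rect] := PYX_law.
have [mQYX QYX_rect] := QYX_law.
have QYX_gauss' : {ae distribution P X, forall x,
    gaussian_law dot e sigma (c (ell c x)) (QYX x)}.
  have [N [mN N0 subN]] := QYX_gauss.
  by exists N; split => //; rewrite -QX.
have aeF := ae_filter_ringOfSetsType (distribution P X : probability (borel H) R).
pose D (x : borel H) := \big[Num.min/`|(x : H) - c ord0| ^+ 2]_(j < k.+1)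
  `|(x : H) - c j| ^+ 2.
have mD : measurable_fun setT D by exact: measurable_min_sqr_dist.
have D0 x : 0 <= D x by rewrite /D min_sqr_dist sqr_ge0.
have C0 : 0 < 2 * sigma ^+ 2 by rewrite mulr_gt0// exprn_gt0.
have QP : {ae distribution P X, forall x, QYX x `<< PYX x /\
    kullback (QYX x) (PYX x) = ((2 * sigma ^+ 2)^-1 * D x)%:E}.
  apply: (@filterS2 _ _ aeF _ _ _ _ PYX_gauss QYX_gauss') => x Px Qx.
  rewrite /D min_sqr_dist mulrC.
  exact: (gaussian_law_kullback norm_dot e_basis sigma_gt0 Px Qx).
split; last first.
  congr (_ * _)%E; apply/esym.
  refine (@kullback_chain_rule R _ _ (borel H) (Rseq R) _ (@rational_ray R) _ _
    (distribution P X) PYX QYX _ _ (distribution Q (joint X Y))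
    (distribution P (joint X Y)) _ _ _) => //.
  - exact: measurable_rational_ray.
  - exact: Rseq_measure_unique.
  - move=> A B mA mB; rewrite (eq_measure_integral (distribution Q X)).
      exact: QYX_rect.
    by move=> C mC _; apply/esym; exact: QX.
  - by apply: (@filterS _ _ aeF _ _ _ QP) => x [].
rewrite (@ae_eq_integral_nonmeasurable _ _ _ _ _
  (fun x => ((2 * sigma ^+ 2)^-1 * D x)%:E)); last 3 first.
- by move=> x; rewrite lee_fin mulr_ge0// invr_ge0 ltW.
- by apply/measurable_EFinP; exact: measurable_funM.
- by apply: (@filterS _ _ aeF _ _ _ QP) => x [].
under eq_integral do rewrite EFinM.
rewrite ge0_integralZl//; last 3 first.
- exact/measurable_EFinP.
- by move=> x _; rewrite lee_fin.
- by rewrite lee_fin invr_ge0 ltW.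
by rewrite muleA -EFinM mulfV ?gt_eqF// mul1e.
Qed.
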